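(* Let $n\geq 2$. Suppose that for every $\epsilon>0$ the local extension estimate $R^*(2\to \frac{2(n+1)}{n-1}\,;\,\epsilon)$ holds. Then the (global) extension estimate $R^*(2\to q)$ holds for every $q>\frac{2(n+1)}{n-1}$.
   Context: Fix $n\geq 2$. The truncated paraboloid is $P^{n-1}=\{(\xi,|\xi|^2)\in\mathbb{R}^n:\ \xi\in[-1,1]^{n-1}\}$, equipped with its surface measure $d\sigma$. The extension operator $E$ is defined on $L^p(P^{n-1},d\sigma)$ by $$Ef(x)=\int_{P^{n-1}}f(\xi)e^{2\pi i x\cdot\xi}\,d\sigma(\xi),\qquad x\in\mathbb{R}^n,$$ where $\xi$ here denotes a point of $P^{n-1}\subset\mathbb{R}^n$. Global estimate: $R^*(p\to q)$ denotes the statement that $E$ is bounded from $L^p(P^{n-1},d\sigma)$ to $L^q(\mathbb{R}^n)$, i.e. there is a finite constant $A$ with $\|Ef\|_{L^q(\mathbb{R}^n)}\leq A\|f\|_{L^p(P^{n-1},d\sigma)}$ for all $f\in L^p(P^{n-1},d\sigma)$. Local estimate: for $\epsilon>0$, $R^*(p\to q\,;\,\epsilon)$ denotes the statement that there is a finite constant $A$ (independent of $R$ and $f$) with $\|Ef\|_{L^q(B(0,R))}\leq A R^{\epsilon}\|f\|_{L^p(P^{n-1},d\sigma)}$ for all $R\geq 1$ and all $f\in L^p(P^{n-1},d\sigma)$, where $B(0,R)\subset\mathbb{R}^n$ is the ball of radius $R$ centred at the origin. *)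

(* Defs.v *)
From HB Require Import structures.
From mathcomp Require Import all_boot all_order all_algebra.
From mathcomp Require Import complex.
From mathcomp Require Import all_classical all_reals all_analysis.
From mathcomp Require Import measurable_realfun.

Set Implicit Arguments.
Unset Strict Implicit.
Unset Printing Implicit Defensive.

Import Order.TTheory GRing.Theory Num.Theory.
Import numFieldNormedType.Exports.

Local Open Scope classical_set_scope.
Local Open Scope ring_scope.

(* R^n is [n.-tuple R], with the product (hence Borel) sigma-algebra.  Lebesgue
   measure on it is the iterated product of one-dimensional Lebesgue measures;
   [lebesgue_tuple_box] is its characteristic property. *)
Section lebesgue_tuple.
Context {R : realType}.

Definition tcons n (p : R * n.-tuple R) : n.+1.-tuple R :=
  [the n.+1.-tuple R of p.1 :: p.2].

Lemma measurable_tcons n : measurable_fun setT (@tcons n).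
Proof. by apply: measurable_cons. Qed.

Section step.
Variables (n : nat) (mu : {sigma_finite_measure set (n.-tuple R) -> \bar R}).

Definition lebesgue_step : set (n.+1.-tuple R) -> \bar R :=
  pushforward (lebesgue_measure \x mu)%E (@tcons n).

Let step0 : lebesgue_step set0 = 0%E.
Proof. by rewrite /lebesgue_step /pushforward preimage_set0 measure0. Qed.

Let step_ge0 A : (0 <= lebesgue_step A)%E.
Proof. by rewrite /lebesgue_step /pushforward; exact: measure_ge0. Qed.

Let step_sigma_additive : semi_sigma_additive lebesgue_step.
Proof.
move=> F mF tF mUF; rewrite /lebesgue_step /pushforward preimage_bigcup.
have mt (A : set (n.+1.-tuple R)) :
  measurable A -> measurable (@tcons n @^-1` A).
  by move=> mA; rewrite -[X in measurable X]setTI; exact: measurable_tcons.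
apply: measure_semi_sigma_additive.
- by move=> k; exact: mt.
- apply/trivIsetP => /= i j _ _ ij; rewrite -preimage_setI.
  by move/trivIsetP : tF => /(_ _ _ _ _ ij) ->//; rewrite preimage_set0.
- by rewrite -preimage_bigcup; exact: mt.
Qed.

HB.instance Definition _ := isMeasure.Build _ _ _ lebesgue_step
  step0 step_ge0 step_sigma_additive.

Let step_sigma_finite : sigma_finite setT lebesgue_step.
Proof.
have /sigma_finiteP[F [TF ndF Foo]] := sigma_finiteT (@lebesgue_measure R).
have /sigma_finiteP[G [TG ndG Goo]] := sigma_finiteT mu.
pose g (t : n.+1.-tuple R) : R * n.-tuple R :=
  (tnth t ord0, [tuple of behead t]).
have gK : cancel (@tcons n) g.
  by move=> [x t]; congr (_, _); apply/val_inj.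
have mg : measurable_fun setT g.
  apply/measurable_fun_pairP; split.
    exact: measurable_tnth.
  exact: measurable_behead.
exists (fun k => g @^-1` (F k `*` G k)).
  rewrite -preimage_bigcup -(preimage_setT g); congr (_ @^-1` _).
  rewrite -setXTT TF TG predeqE => -[x y]; split.
    move=> [/= [i _ Fx] [j _ Gy]]; exists (maxn i j) => //; split.
    - by move: x Fx; exact/subsetPset/ndF/leq_maxl.
    - by move: y Gy; exact/subsetPset/ndG/leq_maxr.
  by move=> [i _ []/= ? ?]; split; exists i.
move=> k; have [mF Fk] := Foo k; have [mG Gk] := Goo k; split.
  by rewrite -[X in measurable X]setTI; apply: mg => //; exact: measurableX.
rewrite /= /lebesgue_step /pushforward -comp_preimage.
rewrite (_ : g \o _ = id); last by apply/funext => x /=; rewrite gK.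
by rewrite preimage_id product_measure1E// lte_mul_pinfty// ge0_fin_numE.
Qed.

HB.instance Definition _ := Measure_isSigmaFinite.Build _ _ _ lebesgue_step
  step_sigma_finite.

End step.

Fixpoint lebesgue_tuple n : {sigma_finite_measure set (n.-tuple R) -> \bar R} :=
  match n with
  | 0 => \d_[tuple]
  | m.+1 => lebesgue_step (lebesgue_tuple m)
  end.

Lemma lebesgue_tuple_box n (A : 'I_n -> set R) :
  (forall i, measurable (A i)) ->
  lebesgue_tuple n [set x | forall i, A i (tnth x i)] =
  (\prod_(i < n) lebesgue_measure (A i))%E.
Proof.
elim: n A => [|n IH] A mA.
  by rewrite big_ord0 /= diracE mem_set// => -[].
rewrite big_ord_recl -IH// -product_measure1E; first last.
- rewrite (_ : [set _ | _] = \bigcap_(i in [set: 'I_n])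
    ((fun x => tnth x i) @^-1` A (lift ord0 i))).
    apply: fin_bigcap_measurable => // i _; rewrite -[X in measurable X]setTI.
    exact: measurable_tnth.
  by apply/seteqP; split => x /= h i; [move=> _|]; apply: h.
- exact: (mA ord0).
congr (product_measure1 _ _ _); apply/seteqP; split => [[x t]|[x t]] /=.
  move=> h; split; first exact: (h ord0).
  by move=> i; have := h (lift ord0 i); rewrite /tcons tnthS.
move=> [h0 h] i; case: (unliftP ord0 i) => [j ->|->//]; rewrite tnthS.
exact: h.
Qed.

End lebesgue_tuple.

Section paraboloid.
Context {R : realType}.

Definition dotp n (x y : n.-tuple R) : R := \sum_(i < n) tnth x i * tnth y i.

Definition enorm n (x : n.-tuple R) : R := Num.sqrt (dotp x x).

Definition cube n : set (n.-tuple R) :=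
  [set xi | forall i, -1 <= tnth xi i <= 1].

(* xi |-> (xi, |xi|^2); n.-1 + 1 and n agree only for 0 < n. *)
Definition lift_paraboloid n (xi : n.-1.-tuple R) : n.-tuple R :=
  [tuple (if (i < n.-1)%N then nth 0 xi i else enorm xi ^+ 2) | i < n].

Definition paraboloid n : set (n.-tuple R) := @lift_paraboloid n @` @cube n.-1.

(* Area element sqrt (1 + |grad |xi|^2|^2) of the graph of xi |-> |xi|^2. *)
Definition surface_density n (xi : n.-tuple R) : R :=
  Num.sqrt (1 + 4 * enorm xi ^+ 2).

(* Measure on all of R^n, carried by the paraboloid: surface area of the part of
   the truncated graph lying in A. *)
Definition surface_measure n (A : set (n.-tuple R)) : \bar R :=
  (\int[lebesgue_tuple n.-1]_(xi in @cube n.-1 `&` @lift_paraboloid n @^-1` A)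
     (surface_density xi)%:E)%E.

Lemma measurable_dotpp n : measurable_fun setT (fun x : n.-tuple R => dotp x x).
Proof.
apply: measurable_sum => i; apply: measurable_funM; exact: measurable_tnth.
Qed.

Lemma measurable_enorm n : measurable_fun setT (@enorm n).
Proof.
apply: measurableT_comp; last exact: measurable_dotpp.
apply: continuous_measurable_fun; exact: sqrt_continuous.
Qed.

Lemma measurable_cube n : measurable (@cube n).
Proof.
rewrite (_ : @cube n = \bigcap_(i in [set: 'I_n])
  ((fun xi => tnth xi i) @^-1` `[-1, 1]%classic)).
  apply: fin_bigcap_measurable => // i _; rewrite -[X in measurable X]setTI.
  by apply: measurable_tnth.
by apply/seteqP; split => xi /= h i; have := h i; rewrite /= in_itv/=; tauto.
Qed.

Lemma measurable_lift_paraboloid n :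
  measurable_fun setT (@lift_paraboloid n).
Proof.
apply/measurable_fun_tnthP => i.
have [ilt|ige] := boolP (i < n.-1)%N.
  rewrite (_ : _ \o _ = fun xi => tnth xi (Ordinal ilt)).
    exact: measurable_tnth.
  by apply/funext => xi /=; rewrite tnth_mktuple ilt (tnth_nth 0).
rewrite (_ : _ \o _ = fun xi => enorm xi ^+ 2).
  by apply: measurable_funX; exact: measurable_enorm.
by apply/funext => xi /=; rewrite tnth_mktuple (negbTE ige).
Qed.

Lemma measurable_surface_density n : measurable_fun setT (@surface_density n).
Proof.
apply: measurableT_comp.
  apply: continuous_measurable_fun; exact: sqrt_continuous.
apply: measurable_funD => //; apply: measurable_funM => //.
by apply: measurable_funX; exact: measurable_enorm.
Qed.

Section surface_measure.
Variable n : nat.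

Let sigma0 : @surface_measure n set0 = 0%E.
Proof. by rewrite /surface_measure preimage_set0 setI0 integral_set0. Qed.

Let sigma_ge0 A : (0 <= @surface_measure n A)%E.
Proof. by apply: integral_ge0 => xi _; rewrite lee_fin sqrtr_ge0. Qed.

Let sigma_additive : semi_sigma_additive (@surface_measure n).
Proof.
move=> F mF tF mUF; rewrite /surface_measure preimage_bigcup setI_bigcupr.
rewrite ge0_integral_bigcup.
- apply: is_cvg_nneseries => k _ _.
  exact: sigma_ge0.
- move=> k; apply: measurableI; first exact: measurable_cube.
  by rewrite -[X in measurable X]setTI; exact: measurable_lift_paraboloid.
- apply/measurable_EFinP; apply: measurable_funTS.
  exact: measurable_surface_density.
- by move=> xi _; rewrite lee_fin sqrtr_ge0.
- apply/trivIsetP => /= i j _ _ ij; rewrite setIACA setIid -preimage_setI.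
  by move/trivIsetP : tF => /(_ _ _ _ _ ij) ->//; rewrite preimage_set0 setI0.
Qed.

HB.instance Definition _ := isMeasure.Build _ _ _ (@surface_measure n)
  sigma0 sigma_ge0 sigma_additive.

End surface_measure.

End paraboloid.

Arguments cube {R} n _.
Arguments paraboloid {R} n _.
Arguments surface_measure {R} n _.

Section complex_functions.
Context {d : measure_display} {T : measurableType d} {R : realType}.
Variable mu : {measure set T -> \bar R}.

(* e^(i t) for real t. *)
Definition cexpi (t : R) : R[i] := (cos t +i* sin t)%C.

Definition cmeasurable_fun (D : set T) (f : T -> R[i]) : Prop :=
  measurable_fun D (fun x => complex.Re (f x)) /\
  measurable_fun D (fun x => complex.Im (f x)).

Definition cintegral (D : set T) (f : T -> R[i]) : R[i] :=
  ((\int[mu]_(x in D) complex.Re (f x)) +i*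
   (\int[mu]_(x in D) complex.Im (f x)))%C.

(* L^p(D, mu) norm of the modulus of f, extended by 0 outside D. *)
Definition cLnorm (D : set T) (p : \bar R) (f : T -> R[i]) : \bar R :=
  'N[mu]_p[(fun x => (Normc.normc (f x))%:E) \_ D].

Definition inLp (D : set T) (p : \bar R) (f : T -> R[i]) : Prop :=
  cmeasurable_fun D f /\ (cLnorm D p f < +oo)%E.

End complex_functions.

Section extension.
Context {R : realType}.

Definition extension n (f : n.-tuple R -> R[i]) (x : n.-tuple R) : R[i] :=
  cintegral (surface_measure n) (paraboloid n)
    (fun xi => f xi * cexpi (2 * pi * dotp x xi)).

Definition eball n (r : R) : set (n.-tuple R) := [set x | enorm x < r].

Arguments eball : clear implicits.

Definition global_extension_estimate n (p q : \bar R) : Prop :=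
  exists A : R, forall f : n.-tuple R -> R[i],
    inLp (surface_measure n) (paraboloid n) p f ->
    (cLnorm (lebesgue_tuple n) setT q (extension f) <=
     A%:E * cLnorm (surface_measure n) (paraboloid n) p f)%E.

Definition local_extension_estimate n (p q : \bar R) (eps : R) : Prop :=
  exists A : R, forall r : R, 1 <= r -> forall f : n.-tuple R -> R[i],
    inLp (surface_measure n) (paraboloid n) p f ->
    (cLnorm (lebesgue_tuple n) (eball n r) q (extension f) <=
     (A * r `^ eps)%:E *
       cLnorm (surface_measure n) (paraboloid n) p f)%E.

End extension.

(* Main.v *)
(* Stein-Tomas argument at the level of superlevel sets.  Let E be a level set
   {Re (Ef) > lam ||f||_2} inside a large cube and E^ its Fourier transform.  By
   duality (lam |E|)^2 is at most the integral of |E^|^2 over the paraboloid, a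
   double integral over pairs of time slices of E, time being the last coordinate.
   Slices at distance < rho contribute O(rho |E|), by Bessel's inequality in the
   other n - 1 variables; the remaining ones contribute O(rho^(-(n-1)/2) |E|^2), by
   the van der Corput bound |t|^(-1/2) for each of the n - 1 one-dimensional
   factors of the kernel.  Choosing rho as a power of lam gives the weak-type
   bound |E| <= C lam^(-2(n+1)/(n-1)).  Since |Ef| <= C ||f||_2 pointwise, summing
   over dyadic levels gives L^q for every larger q, including q = oo. *)
From HB Require Import structures.
Require Import Defs.
From mathcomp Require Import all_boot all_order all_algebra.
From mathcomp Require Import complex.
From mathcomp Require Import all_classical all_reals all_analysis.
From mathcomp Require Import measurable_realfun ring lra.

Set Implicit Arguments.
Unset Strict Implicit.
Unset Printing Implicit Defensive.

Import Order.TTheory GRing.Theory Num.Theory.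
Import numFieldNormedType.Exports.

Local Open Scope classical_set_scope.
Local Open Scope ring_scope.

(** * Bounded measurable functions on finite measure spaces *)

(** Indicator functions make the argument close: the integral of an indicator equals that of its
    square, so Bessel's inequality on slices is linear in [|E|] while the far term is quadratic.
    Taking [rho] of size [lam^(-4/(n-1))] makes the far term half of [(lam |E|)^2]; it is absorbed,
    and the rest, [|E| <= C rho / lam^2], has exactly the Stein-Tomas exponent.

    Absorption divides by [|E|], so finiteness must be known beforehand. This is why [E] is cut to a
    cube of half-side [M], with constants independent of [M]. The cut also makes every measure
    finite: functions that are measurable and bounded everywhere are then integrable and stable
    under products and partial integration, which turns the side conditions of Fubini into algebra.
    Only the input function [f] falls outside this class.

    Complex exponentials are replaced by cosines with an arbitrary phase shift. A shift by [pi / 2]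
    produces the sine and a shift by [pi] changes the sign, so a one-sided real bound that is
    uniform in the shift carries all the information. *)

Definition bounded_measurable d (T : measurableType d) (R : realType)
  (f : T -> R) : Prop :=
  measurable_fun setT f /\ exists M, forall x, `|f x| <= M.

Section bounded_measurable_algebra.
Context d (T : measurableType d) (R : realType).
Implicit Types f g : T -> R.

Lemma bm_cst (c : R) : bounded_measurable (fun _ : T => c).
Proof. by split; [exact: measurable_cst|exists `|c|]. Qed.

Lemma bmD f g : bounded_measurable f -> bounded_measurable g ->
  bounded_measurable (fun x => f x + g x).
Proof.
move=> [mf [M fM]] [mg [N gN]]; split; first exact: measurable_funD.
by exists (M + N) => x; rewrite (le_trans (ler_normD _ _))// lerD.
Qed.

Lemma bmN f : bounded_measurable f -> bounded_measurable (fun x => - f x).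
Proof.
move=> [mf [M fM]]; split; first exact: measurable_funN.
by exists M => x; rewrite normrN.
Qed.

Lemma bmB f g : bounded_measurable f -> bounded_measurable g ->
  bounded_measurable (fun x => f x - g x).
Proof. by move=> bf bg; apply: bmD => //; exact: bmN. Qed.

Lemma bmM f g : bounded_measurable f -> bounded_measurable g ->
  bounded_measurable (fun x => f x * g x).
Proof.
move=> [mf [M fM]] [mg [N gN]]; split; first exact: measurable_funM.
by exists (M * N) => x; rewrite normrM ler_pM.
Qed.

Lemma bm_norm f : bounded_measurable f -> bounded_measurable (fun x => `|f x|).
Proof.
move=> [mf [M fM]]; split; first exact: measurableT_comp.
by exists M => x; rewrite normr_id.
Qed.

Lemma bmX f n : bounded_measurable f -> bounded_measurable (fun x => f x ^+ n).
Proof.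
move=> bf; elim: n => [|n IH]; first exact: bm_cst.
by under eq_fun do rewrite exprS; exact: bmM.
Qed.

Lemma bm_cos f : measurable_fun setT f ->
  bounded_measurable (fun x => cos (f x)).
Proof.
move=> mf; split; last by exists 1 => x; rewrite ler_norml cos_geN1 cos_le1.
apply: measurableT_comp => //; apply: continuous_measurable_fun.
exact: continuous_cos.
Qed.

Lemma bm_sin f : measurable_fun setT f ->
  bounded_measurable (fun x => sin (f x)).
Proof.
move=> mf; split; last by exists 1 => x; rewrite ler_norml sin_geN1 sin_le1.
apply: measurableT_comp => //; apply: continuous_measurable_fun.
exact: continuous_sin.
Qed.

Lemma bm_indic (A : set T) : measurable A ->
  bounded_measurable (\1_A : T -> R).
Proof.
move=> mA; split; first exact: measurable_indic.
by exists 1 => x; rewrite indicE; case: (_ \in _); rewrite ?normr0 ?normr1.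
Qed.

End bounded_measurable_algebra.

Lemma bm_comp d1 d2 (T1 : measurableType d1) (T2 : measurableType d2)
    (R : realType) (f : T2 -> R) (g : T1 -> T2) :
  bounded_measurable f -> measurable_fun setT g ->
  bounded_measurable (fun x => f (g x)).
Proof.
move=> [mf [M fM]] mg; split; first exact: measurableT_comp.
by exists M => x.
Qed.

Section bounded_measurable_integral.
Context d (T : measurableType d) (R : realType).
Variable mu : {finite_measure set T -> \bar R}.
Implicit Types f g : T -> R.

Lemma bm_integrable f : bounded_measurable f ->
  mu.-integrable setT (EFin \o f).
Proof.
move=> [mf [M fM]]; apply: measurable_bounded_integrable => //.
  by rewrite ltey_eq fin_num_measure.
by exists M; split; [exact: num_real|move=> N MN x _; exact: le_trans (ltW MN)].
Qed.

Lemma bm_integralE f : bounded_measurable f ->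
  (\int[mu]_x (f x)%:E)%E = (\int[mu]_x f x)%:E.
Proof.
by move=> bf; rewrite fineK//; apply: integrable_fin_num => //;
  exact: bm_integrable.
Qed.

Lemma bm_integral_ge0 f : (forall x, 0 <= f x) -> 0 <= \int[mu]_x f x.
Proof. by move=> f0; apply: Rintegral_ge0. Qed.

Lemma bm_le_integral f g : bounded_measurable f -> bounded_measurable g ->
  (forall x, f x <= g x) -> \int[mu]_x f x <= \int[mu]_x g x.
Proof.
by move=> bf bg fg; apply: le_Rintegral => //; exact: bm_integrable.
Qed.

Lemma bm_integralD f g : bounded_measurable f -> bounded_measurable g ->
  \int[mu]_x (f x + g x) = \int[mu]_x f x + \int[mu]_x g x.
Proof. by move=> bf bg; apply: RintegralD => //; exact: bm_integrable. Qed.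

Lemma bm_integralB f g : bounded_measurable f -> bounded_measurable g ->
  \int[mu]_x (f x - g x) = \int[mu]_x f x - \int[mu]_x g x.
Proof. by move=> bf bg; apply: RintegralB => //; exact: bm_integrable. Qed.

Lemma bm_integralZl f c : bounded_measurable f ->
  \int[mu]_x (c * f x) = c * \int[mu]_x f x.
Proof. by move=> bf; apply: RintegralZl => //; exact: bm_integrable. Qed.

Lemma bm_integralZr f c : bounded_measurable f ->
  \int[mu]_x (f x * c) = \int[mu]_x f x * c.
Proof. by move=> bf; apply: RintegralZr => //; exact: bm_integrable. Qed.

Lemma bm_le_normr_integral f : bounded_measurable f ->
  `|\int[mu]_x f x| <= \int[mu]_x `|f x|.
Proof. by move=> bf; apply: le_normr_Rintegral => //; exact: bm_integrable. Qed.

End bounded_measurable_integral.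

Lemma eq_integralT d (T : measurableType d) (R : realType)
    (mu : {measure set T -> \bar R}) (f g : T -> R) :
  f =1 g -> \int[mu]_x f x = \int[mu]_x g x.
Proof. by move=> fg; apply: eq_Rintegral => x _. Qed.
Arguments eq_integralT {d T R mu f} g.

Section bounded_measurable_fubini.
Context d1 d2 (T1 : measurableType d1) (T2 : measurableType d2) (R : realType).
Variables (m1 : {finite_measure set T1 -> \bar R}).
Variables (m2 : {finite_measure set T2 -> \bar R}).

Lemma bm_section1 (f : T1 -> T2 -> R) x :
  bounded_measurable (fun p => f p.1 p.2) -> bounded_measurable (f x).
Proof.
move=> bf; apply: (bm_comp (g := fun y => (x, y)) bf).
exact: pair1_measurable.
Qed.

Lemma bm_section2 (f : T1 -> T2 -> R) y :
  bounded_measurable (fun p => f p.1 p.2) ->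
  bounded_measurable (fun x => f x y).
Proof.
move=> bf; apply: (bm_comp (g := fun x => (x, y)) bf).
exact: pair2_measurable.
Qed.

Lemma bm_product_integrable (f : T1 -> T2 -> R) :
  bounded_measurable (fun p => f p.1 p.2) ->
  (m1 \x m2)%E.-integrable setT (EFin \o (fun p => f p.1 p.2)).
Proof.
move=> [mf [M fM]]; apply: measurable_bounded_integrable => //.
  rewrite [X in (X < _)%E](_ : _ = (m1 setT * m2 setT)%E); last first.
    by rewrite -product_measure1E// setXTT.
  by rewrite ltey_eq fin_numM// fin_num_measure.
by exists M; split; [exact: num_real|move=> N MN x _; exact: le_trans (ltW MN)].
Qed.

(** Closure under partial integration lets the later triple and quadruple integrals be reordered by
    repeated use of the two-variable [bm_fubini]. *)
Lemma bm_integral (f : T1 -> T2 -> R) :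
  bounded_measurable (fun p => f p.1 p.2) ->
  bounded_measurable (fun x => \int[m2]_y f x y).
Proof.
move=> bf; have [mf [M fM]] := bf; split.
  apply/measurable_EFinP.
  (* Measurability in x does not involve a measure on T1: use the zero one. *)
  have if0 : (@mzero _ T1 R \x m2)%E.-integrable setT
      (EFin \o (fun p => f p.1 p.2)).
    apply/(integrable12ltyP mzero m2); first exact/measurable_EFinP.
    by rewrite integral_measure_zero ltry.
  have := measurable_fubini_F if0.
  congr measurable_fun; apply/funext => x/=.
  by rewrite /fubini_F /= bm_integralE//; exact: bm_section1.
exists (M * fine (m2 setT)) => x.
have bx : bounded_measurable (f x) by exact: bm_section1.
rewrite (le_trans (bm_le_normr_integral m2 bx))//.
rewrite -Rintegral_cst//; apply: bm_le_integral => //; first exact: bm_norm.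
  exact: bm_cst.
by move=> y; exact: (fM (x, y)).
Qed.

Lemma bm_fubini (f : T1 -> T2 -> R) :
  bounded_measurable (fun p => f p.1 p.2) ->
  \int[m1]_x \int[m2]_y f x y = \int[m2]_y \int[m1]_x f x y.
Proof.
move=> bf; congr fine.
transitivity (\int[m1]_x \int[m2]_y (f x y)%:E)%E.
  by apply: eq_integral => x _; rewrite bm_integralE//; exact: bm_section1.
rewrite (Fubini (bm_product_integrable bf)).
by apply: eq_integral => y _; rewrite -bm_integralE//; exact: bm_section2.
Qed.

Lemma bm_product_integral (f : T1 -> T2 -> R) :
  bounded_measurable (fun p => f p.1 p.2) ->
  fine (\int[m1 \x m2]_p (f p.1 p.2)%:E) = \int[m1]_x \int[m2]_y f x y.
Proof.
move=> bf; have := integral12_prod_meas1 (bm_product_integrable bf).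
rewrite /fubini_F /= => <-; congr fine; apply: eq_integral => x _.
by rewrite bm_integralE//; exact: bm_section1.
Qed.

End bounded_measurable_fubini.

(** * Lebesgue measure on cubes *)

Section restricted_measures.
Context {R : realType}.

Definition box (r : R) n : set (n.-tuple R) :=
  [set x | forall i, -r <= tnth x i <= r].

Lemma measurable_box r n : measurable (@box r n).
Proof.
rewrite (_ : @box r n = \bigcap_(i in [set: 'I_n])
  ((fun xi => tnth xi i) @^-1` `[-r, r]%classic)).
  apply: fin_bigcap_measurable => // i _; rewrite -[X in measurable X]setTI.
  by apply: measurable_tnth.
by apply/seteqP; split => xi /= h i; have := h i; rewrite /= in_itv/=; tauto.
Qed.

Lemma box_bigcup n : \bigcup_(k : nat) (@box k%:R n) = setT.
Proof.
apply/seteqP; split => // x _.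
pose M := \sum_(i < n) `|tnth x i|.
have M0 : 0 <= M by apply: sumr_ge0.
exists (Num.truncn M).+1 => // i; rewrite -ler_norml.
apply: le_trans (ltW (Num.Theory.truncnS_gt M)).
by rewrite /M (bigD1 i)//= lerDl sumr_ge0.
Qed.

Lemma subset_box n (r s : R) : r <= s -> @box r n `<=` @box s n.
Proof.
move=> rs x bx i; have /andP[a b] := bx i.
by rewrite (le_trans b rs) (le_trans _ a)// lerN2.
Qed.

(** The cut-off sits in the measure and not in the domain of integration: the total mass is then
    finite, and functions defined on the whole line are integrated over [setT]. [leb_box] follows
    the same pattern. *)
Definition leb_itv (r : R) (A : set R) : \bar R :=
  lebesgue_measure (A `&` `[-r, r]).

Let leb_itv0 r : leb_itv r set0 = 0%E.
Proof. by rewrite /leb_itv set0I measure0. Qed.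

Let leb_itv_ge0 r A : (0 <= leb_itv r A)%E.
Proof. exact: measure_ge0. Qed.

Let leb_itv_sigma_additive r : semi_sigma_additive (leb_itv r).
Proof.
exact: (@measure_semi_sigma_additive _ _ _
  (mrestr lebesgue_measure (measurable_itv `[-r, r]))).
Qed.

HB.instance Definition _ r := isMeasure.Build _ _ _ (leb_itv r)
  (leb_itv0 r) (leb_itv_ge0 r) (@leb_itv_sigma_additive r).

Let leb_itv_fin r : fin_num_fun (leb_itv r).
Proof.
move=> A mA; rewrite ge0_fin_numE//.
apply: (@le_lt_trans _ _ (lebesgue_measure `[-r, r]%classic)).
  rewrite /leb_itv; apply: le_measure => //; rewrite inE//.
  exact: measurableI.
by rewrite lebesgue_measure_itv; case: ifPn => //= _; rewrite -EFinB ltry.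
Qed.

HB.instance Definition _ r := Measure_isFinite.Build _ _ _ (leb_itv r)
  (leb_itv_fin r).

Definition leb_box (r : R) n : set (n.-tuple R) -> \bar R :=
  mrestr (lebesgue_tuple n) (@measurable_box r n).

HB.instance Definition _ r n := Measure.copy (@leb_box r n)
  (mrestr (lebesgue_tuple n) (@measurable_box r n)).

Let leb_box_fin r n : fin_num_fun (@leb_box r n).
Proof.
move=> A mA; rewrite ge0_fin_numE//.
apply: (@le_lt_trans _ _ (lebesgue_tuple n (@box r n))).
  rewrite /leb_box /mrestr; apply: le_measure => //; rewrite inE//.
  - by apply: measurableI => //; exact: measurable_box.
  - exact: measurable_box.
have -> : @box r n = [set x | forall i, (fun=> `[-r, r]%classic) i (tnth x i)].
  by apply/seteqP; split => x /= h i; have := h i; rewrite in_itv.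
rewrite (lebesgue_tuple_box (A := fun=> `[-r, r]%classic))//.
rewrite -ge0_fin_numE; last first.
  by apply: prode_ge0 => i _; exact: measure_ge0.
apply: prode_fin_num => i _; rewrite lebesgue_measure_itv.
by case: ifPn => //= _; rewrite -EFinB.
Qed.

HB.instance Definition _ r n := Measure_isFinite.Build _ _ _ (@leb_box r n)
  (@leb_box_fin r n).

End restricted_measures.

Arguments box {R} r n _.
Arguments leb_box {R} r n _.
Arguments leb_itv {R} r _.

Lemma integral_mrestr d (T : measurableType d) (R : realType)
    (mu : {measure set T -> \bar R}) (D : set T) (mD : measurable D)
    (f : T -> \bar R) : measurable_fun setT f ->
  (\int[mrestr mu mD]_x f x = \int[mu]_(x in D) f x)%E.
Proof.
move=> mf; have mDc : measurable (~` D) by exact: measurableC.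
rewrite -{1}(setvU D) integral_setU//=; first last.
- by rewrite disj_set2E setICl.
- by rewrite setvU.
rewrite [X in (X + _)%E]null_set_integral//; last 2 first.
- exact: measurable_funTS.
- by rewrite /= /mrestr setICl measure0.
rewrite add0e; apply: eq_measure_integral => A mA AD.
by rewrite /= /mrestr setIidl.
Qed.

Section box_integrals.
Context {R : realType}.

(* [lebesgue_measure] lives on [measurableTypeR R], whose display differs from
   that of the canonical structure on [R]; [idR] transports between them. *)
Let idR : measurableTypeR R -> R := fun x => x.

Let measurable_idR : measurable_fun setT idR.
Proof. by move=> _ Y mY; rewrite setTI. Qed.

Lemma leb_itv_integralE (r : R) (f : R -> \bar R) : measurable_fun setT f ->
  (\int[leb_itv r]_x f x = \int[lebesgue_measure]_(x in `[(- r)%R, r]) f x)%E.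
Proof.
pose m := mrestr lebesgue_measure (measurable_itv `[-r, r]).
have main (g : R -> \bar R) : measurable_fun setT g ->
    (forall x, 0 <= g x)%E ->
    (\int[leb_itv r]_x g x = \int[lebesgue_measure]_(x in `[(- r)%R, r]) g x)%E.
  move=> mg g0.
  transitivity (\int[pushforward m idR]_x g x)%E.
    by apply: eq_measure_integral.
  rewrite ge0_integral_pushforward// preimage_setT.
  rewrite -(integral_mrestr lebesgue_measure (measurable_itv `[-r, r]))//.
move=> mf; rewrite integralE main; [|exact: measurable_funepos|by []].
by rewrite main; [rewrite [RHS]integralE|exact: measurable_funeneg|by []].
Qed.

Lemma leb_itv_integral (r : R) (f : R -> R) : bounded_measurable f ->
  \int[leb_itv r]_x f x = \int[lebesgue_measure]_(x in `[-r, r]) f x.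
Proof.
move=> [mf _]; congr fine; rewrite leb_itv_integralE//.
exact/measurable_EFinP.
Qed.

Lemma leb_boxS (r : R) n (A : set (n.+1.-tuple R)) : measurable A ->
  leb_box r n.+1 A = (leb_itv r \x leb_box r n)%E (@tcons R n @^-1` A).
Proof.
move=> mA.
have mtA : measurable (@tcons R n @^-1` A).
  by rewrite -[X in measurable X]setTI; exact: measurable_tcons.
rewrite [RHS]/product_measure1 leb_itv_integralE//; last first.
  exact: measurable_fun_xsection.
rewrite integral_mkcond; apply: eq_integral => a _ /=.
rewrite patchE; case: ifPn => [|] aI.
  rewrite /leb_box /mrestr/=; congr (lebesgue_tuple n _).
  apply/seteqP; split => y /=; rewrite /xsection/= !inE /=.
    move=> [Ay bxy]; split => // i.
    by have := bxy (lift ord0 i); rewrite /tcons tnthS.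
  move=> [Ay byx]; split => // i; case: (unliftP ord0 i) => [j ->|->].
    by rewrite tnthS.
  by move: aI; rewrite inE /= in_itv.
rewrite (_ : xsection _ _ = set0) ?measure0//; apply/seteqP; split => // y /=.
rewrite /xsection /= inE => -[_ /(_ ord0)].
by move: aI; rewrite notin_setE /= in_itv/= => h1 h2; apply: h1.
Qed.

Lemma bm_tcons n (F : n.+1.-tuple R -> R) : bounded_measurable F ->
  bounded_measurable (fun p : R * n.-tuple R => F (tcons (p.1, p.2))).
Proof.
move=> bF; apply: (bm_comp bF).
rewrite (_ : (fun _ => _) = @tcons R n); first exact: measurable_tcons.
by apply/funext => -[].
Qed.

Lemma leb_box_integralS (r : R) n (F : n.+1.-tuple R -> R) :
  bounded_measurable F ->
  \int[leb_box r n.+1]_x F x =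
  \int[leb_itv r]_a \int[leb_box r n]_y F (tcons (a, y)).
Proof.
move=> bF; pose G a y := F (tcons (a, y)).
have bG : bounded_measurable (fun p => G p.1 p.2) by exact: bm_tcons.
rewrite -(bm_product_integral (leb_itv r) (leb_box r n) bG).
congr fine; have [mF _] := bF.
transitivity (\int[leb_itv r \x leb_box r n]_p ((EFin \o F) (tcons p)))%E;
  last by apply: eq_integral => -[a y] _.
have iF : (leb_itv r \x leb_box r n)%E.-integrable (@tcons R n @^-1` setT)
    ((EFin \o F) \o @tcons R n).
  rewrite preimage_setT.
  have := bm_product_integrable (leb_itv r) (leb_box r n) bG.
  by congr integrable; apply/funext => -[].
have mEF : measurable_fun setT (EFin \o F) by exact/measurable_EFinP.
have := integral_pushforward (@measurable_tcons R n) mEF iF measurableT.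
rewrite preimage_setT => <-.
by apply: eq_measure_integral => [|mt A mA _]; [exact: measurable_tcons|exact: leb_boxS].
Qed.

Lemma leb_box0_integral (r : R) (F : 0.-tuple R -> R) :
  \int[leb_box r 0]_x F x = F [tuple].
Proof.
rewrite /Rintegral (_ : (fun x => _) = cst (F [tuple])%:E); last first.
  by apply/funext => x; rewrite (tuple0 x).
rewrite integral_cst//= /leb_box /mrestr setTI /= indicE mem_set ?mulr1//.
by move=> [].
Qed.

End box_integrals.

(** * One-dimensional oscillatory integrals *)

Section one_dimensional_integrals.
Context {R : realType}.
Implicit Types (f F P p : R -> R) (a b t x y theta : R).

Lemma derivable_continuous_at (f : R -> R) : (forall x, derivable f x 1) -> continuous f.
Proof. by move=> df x; apply/differentiable_continuous/derivable1_diffP/df. Qed.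

Lemma is_derive_congr (F : R -> R) x a b :
  is_derive x 1 F a -> a = b -> is_derive x 1 F b.
Proof. by move=> dF <-. Qed.

Lemma continuous_itv_integrable f a b : continuous f ->
  lebesgue_measure.-integrable `[a, b] (EFin \o f).
Proof.
move=> cf; apply: continuous_compact_integrable; first exact: segment_compact.
exact: continuous_subspaceT.
Qed.

Lemma integral_itv_deriv F f a b : a < b -> continuous f ->
  (forall x, is_derive x 1 F (f x)) ->
  \int[lebesgue_measure]_(x in `[a, b]) f x = F b - F a.
Proof.
move=> ab cf dF; have cF : continuous F.
  by apply: derivable_continuous_at => x; apply: ex_derive.
rewrite /Rintegral (@continuous_FTC2 _ f F)//.
- exact: continuous_subspaceT.
- split.
  + by move=> x _; apply: ex_derive.
  + by apply: cvg_at_right_filter; exact: cF.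
  + by apply: cvg_at_left_filter; exact: cF.
- by move=> x _; rewrite derive1E; apply: derive_val.
Qed.

(** Both oscillatory estimates below rest on this comparison: instead of integrating by parts and
    estimating an error integral, one exhibits a small [P] whose derivative dominates the
    integrand. *)
Lemma integral_itv_le_deriv P p f a b : a < b -> continuous f -> continuous p ->
  (forall x, is_derive x 1 P (p x)) -> (forall x, a <= x <= b -> f x <= p x) ->
  \int[lebesgue_measure]_(x in `[a, b]) f x <= P b - P a.
Proof.
move=> ab cf cp dP fp; rewrite -(integral_itv_deriv ab cp dP).
apply: le_Rintegral => //.
- exact: continuous_itv_integrable.
- exact: continuous_itv_integrable.
Qed.

Lemma vdc_quadratic_le t x theta a b : 0 < t -> a < b ->
  \int[lebesgue_measure]_(y in `[a, b]) cos (x * y + t * y ^+ 2 + theta) <=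
  7 / Num.sqrt t.
Proof.
move=> t0 ab.
pose s := Num.sqrt t.
have s0 : 0 < s by rewrite sqrtr_gt0.
have s2 : s ^+ 2 = t by rewrite sqr_sqrtr// ltW.
pose phi y := x * y + t * y ^+ 2 + theta.
pose u y := x + 2 * t * y.
(* Integrating by parts with [u / (u ^+ 2 + t)] in place of the singular
   [1 / u], [u = phi'], gives a primitive [P] of size [O(1 / s)] whose derivative
   dominates [cos phi] on the whole line; the [atan] term absorbs the error. *)
pose P y := u y * sin (phi y) * (u y ^+ 2 + t)^-1
  + 3 / (2 * s) * atan (s^-1 * u y).
have den y : 0 < u y ^+ 2 + t by rewrite ltr_wpDl// sqr_ge0.
have denN y : u y ^+ 2 + t != 0 by rewrite gt_eqF.
pose p y := u y ^+ 2 * cos (phi y) / (u y ^+ 2 + t)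
  + 2 * t * (t - u y ^+ 2) * sin (phi y) / (u y ^+ 2 + t) ^+ 2
  + 3 * t / (u y ^+ 2 + t).
have dphi y : is_derive y 1 phi (u y).
  rewrite /phi /u; apply: is_derive_eq.
  by rewrite /GRing.scale/=; ring.
have du y : is_derive y 1 u (2 * t).
  rewrite /u; apply: is_derive_eq.
  by rewrite /GRing.scale/=; ring.
have dsin y : is_derive y 1 (sin \o phi) (u y * cos (phi y)).
  have := @is_derive1_comp _ sin phi y _ _ (is_derive_sin (phi y)) (dphi y).
  by rewrite mulrC.
have dinv y : is_derive y 1 (fun z => (u z ^+ 2 + t)^-1)
    (- (4 * t * u y) / (u y ^+ 2 + t) ^+ 2).
  have dd : is_derive y 1 (fun z => u z ^+ 2 + t) (4 * t * u y).
    apply: is_derive_eq; rewrite /GRing.scale/=; ring.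
  apply: is_derive_congr (is_deriveV (f := fun z => u z ^+ 2 + t) (denN y) dd) _.
  by rewrite /GRing.scale/=; field.
have datan y : is_derive y 1 (atan \o (fun z => s^-1 * u z))
    (2 * s * t / (u y ^+ 2 + t)).
  have dd : is_derive y 1 (fun z => s^-1 * u z) (2 * s).
    apply: is_derive_eq; rewrite /GRing.scale/= -s2; field.
    by rewrite gt_eqF.
  apply: is_derive_congr (is_derive1_comp (is_derive1_atan _) dd) _.
  have sn0 : s != 0 by rewrite gt_eqF.
  rewrite /= -s2. field.
  by rewrite sn0 s2 denN.
have dP y : is_derive y 1 P (p y).
  have -> : P = (u * (sin \o phi) * (fun z => (u z ^+ 2 + t)^-1)
     + (3 / (2 * s)) \*: (atan \o (fun z => s^-1 * u z))) by [].
  apply: is_derive_eq; rewrite /p /GRing.scale !fctE /=.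
  have sn0 : s != 0 by rewrite gt_eqF.
  by field; rewrite sn0 denN.
have dcos y : is_derive y 1 (cos \o phi) (- sin (phi y) * u y).
  exact: is_derive1_comp.
have cp : continuous p.
  apply: derivable_continuous_at => y.
  have -> : p = (u ^+ 2 * (cos \o phi) * (fun z => (u z ^+ 2 + t)^-1)
    + (2 * t) \*: ((cst t - u ^+ 2) * (sin \o phi) *
        (fun z => (u z ^+ 2 + t)^-1) ^+ 2)
    + (3 * t) \*: (fun z => (u z ^+ 2 + t)^-1)).
    apply/funext => z; rewrite /p /= !fctE /= -exprVn /GRing.scale/=; ring.
  exact: ex_derive.
have cc : continuous (fun y => cos (phi y)).
  by apply: derivable_continuous_at => y; apply: (ex_derive (f := cos \o phi)).
apply: le_trans (integral_itv_le_deriv ab cc cp dP _) _.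
  move=> y _; rewrite /p -subr_ge0.
  (* Of the coefficient 3 in the [atan] term, one unit pays for the missing [t * cos phi] and two
     pay for the sine error; what is left over is a combination of [1 - cos] and [1 + sin],
     [1 - sin] with nonnegative coefficients. *)
  have -> : u y ^+ 2 * cos (phi y) / (u y ^+ 2 + t) +
      2 * t * (t - u y ^+ 2) * sin (phi y) / (u y ^+ 2 + t) ^+ 2 +
      3 * t / (u y ^+ 2 + t) - cos (phi y) =
      (t * (1 - cos (phi y)) * (u y ^+ 2 + t)
        + 2 * t * (t * (1 + sin (phi y)) + u y ^+ 2 * (1 - sin (phi y))))
      / (u y ^+ 2 + t) ^+ 2.
    by field; exact: denN.
  have := cos_le1 (phi y); have := sin_le1 (phi y); have := sin_geN1 (phi y).
  move=> h1 h2 h3; rewrite divr_ge0 ?sqr_ge0// addr_ge0//.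
    by rewrite !mulr_ge0 ?(ltW t0) ?(ltW (den y))// subr_ge0.
  rewrite mulr_ge0 ?(ltW t0)// ?mulr_ge0 ?(ltW t0)// addr_ge0//.
    by rewrite mulr_ge0 ?(ltW t0)//; lra.
  by rewrite mulr_ge0 ?sqr_ge0// subr_ge0.
(* The inequality [2 s |u| <= u^2 + s^2] bounds the first term by [1 / (2 s)], and
   [|atan| < pi / 2 < 2] bounds the second by [3 / s]. The two endpoints together give the constant
   7. *)
have bP y : `|P y| <= (7 / 2) / s.
  apply: le_trans (ler_normD _ _) _.
  have -> : 7 / 2 / s = (2 * s)^-1 + 3 / s.
    by field; rewrite gt_eqF.
  apply: lerD.
    rewrite normrM normfV (gtr0_norm (den y)) ler_pdivrMr//.
    rewrite ler_pdivlMl ?mulr_gt0//.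
    apply: (@le_trans _ _ (2 * s * `|u y|)).
      rewrite ler_wpM2l ?mulr_ge0 ?(ltW s0)// normrM.
      by rewrite ler_piMr// ler_norml sin_geN1 sin_le1.
    rewrite -s2 -subr_ge0 -[u y ^+ 2]real_normK ?num_real//.
    have -> : `|u y| ^+ 2 + s ^+ 2 - 2 * s * `|u y| = (`|u y| - s) ^+ 2 by ring.
    exact: sqr_ge0.
  rewrite normrM ger0_norm; last by rewrite divr_ge0 ?mulr_ge0 ?(ltW s0).
  apply: (@le_trans _ _ (3 / (2 * s) * 2)); last first.
    by rewrite le_eqVlt; apply/orP; left; apply/eqP; field; rewrite gt_eqF.
  rewrite ler_wpM2l ?divr_ge0 ?mulr_ge0 ?(ltW s0)// ler_norml.
  have pi4 := @pihalf_lt2 R.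
  by rewrite (le_trans _ (ltW (atan_gtNpi2 _))) ?(le_trans (ltW (atan_ltpi2 _)))//; lra.
rewrite (le_trans (ler_norm _))// (le_trans (ler_normB _ _))//.
by rewrite (le_trans (lerD (bP _) (bP _)))// -/s -mulrDl; lra.
Qed.

End one_dimensional_integrals.

Section one_dimensional_kernels.
Context {R : realType}.
Implicit Types (t x y theta : R).

(** The upper bound holds for every [theta], so replacing [theta] by [theta + pi] yields the lower
    bound; evenness of the cosine reduces negative [t] to positive [t]. *)
Lemma vdc_quadratic t x theta : t != 0 ->
  `|\int[leb_itv 1]_y cos (x * y + t * y ^+ 2 + theta)| <=
  7 / Num.sqrt `|t|.
Proof.
have mphi (x' t' th : R) :
    measurable_fun setT (fun y => x' * y + t' * y ^+ 2 + th).
  apply: continuous_measurable_fun; apply: derivable_continuous_at => y.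
  exact: ex_derive.
have pos t' x' th : 0 < t' ->
    \int[leb_itv 1]_y cos (x' * y + t' * y ^+ 2 + th) <= 7 / Num.sqrt t'.
  move=> t0; rewrite leb_itv_integral; last exact: bm_cos.
  by apply: vdc_quadratic_le => //; lra.
have both t' x' th : 0 < t' ->
    `|\int[leb_itv 1]_y cos (x' * y + t' * y ^+ 2 + th)| <= 7 / Num.sqrt t'.
  move=> t0; rewrite ler_norml pos// andbT lerNl.
  rewrite -mulN1r -bm_integralZl; last exact: bm_cos.
  apply: le_trans (pos t' x' (th + pi) t0); rewrite le_eqVlt; apply/orP; left.
  apply/eqP/eq_integralT => y; rewrite addrA cosDpi mulN1r//.
have [t0|t0|//] := ltrgt0P t => _; first exact: both.
rewrite (eq_integralT (fun y => cos (- x * y + - t * y ^+ 2 + - theta))).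
  by apply: both; rewrite oppr_gt0.
by move=> y; rewrite -cosN; congr cos; ring.
Qed.

(* A nonnegative weight, at least 3 on [-1, 1] and vanishing at the ends of
   [-2, 2], so that its Fourier transform is integrable. *)
Definition parabola_cap (y : R) : R := Num.max 0 (4 - y ^+ 2).

Lemma parabola_cap_ge0 y : 0 <= parabola_cap y.
Proof. by rewrite /parabola_cap le_max lexx. Qed.

Lemma parabola_cap_le4 y : parabola_cap y <= 4.
Proof. by rewrite /parabola_cap ge_max lerBlDr lerDl sqr_ge0 andbT. Qed.

Lemma parabola_capE y : -2 <= y <= 2 -> parabola_cap y = 4 - y ^+ 2.
Proof. by move=> /andP[y1 y2]; rewrite /parabola_cap; apply/max_idPr; nra. Qed.

Lemma bm_parabola_cap : bounded_measurable parabola_cap.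
Proof.
split.
  apply: measurable_maxr => //; apply: measurable_funB => //.
by exists 4 => y; rewrite ger0_norm ?parabola_cap_ge0 ?parabola_cap_le4.
Qed.

(** Since the cap vanishes at both ends of [[-2, 2]], two integrations by parts gain [x^-2].
    Estimating [1 + x^2] times the integral treats small and large frequencies together. *)
Lemma integral_parabola_cap_cos x theta :
  `|\int[leb_itv 2]_y (parabola_cap y * cos (x * y + theta))| <= 32 / (1 + x ^+ 2).
Proof.
have x21 : 0 < 1 + x ^+ 2 by rewrite ltr_pwDl// sqr_ge0.
have dphi th y : is_derive y 1 (fun z => x * z + th) x.
  by apply: is_derive_eq; rewrite /GRing.scale/=; ring.
have dcos th y : is_derive y 1 (cos \o (fun z => x * z + th))
    (- sin (x * y + th) * x) by exact: is_derive1_comp.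
have dsin th y : is_derive y 1 (sin \o (fun z => x * z + th))
    (cos (x * y + th) * x) by exact: is_derive1_comp.
have mphi th : measurable_fun setT (fun y => x * y + th).
  apply: continuous_measurable_fun; apply: derivable_continuous_at => y.
  exact: ex_derive.
have bph th : bounded_measurable (fun y => parabola_cap y * cos (x * y + th)).
  by apply: bmM; [exact: bm_parabola_cap|exact: bm_cos].
have pos th :
    \int[leb_itv 2]_y (parabola_cap y * cos (x * y + th)) <= 32 / (1 + x ^+ 2).
  rewrite ler_pdivlMr// mulrC -bm_integralZl// leb_itv_integral; last first.
    by apply: bmM => //; exact: bm_cst.
  pose c := cos \o (fun z => x * z + th).
  pose s := sin \o (fun z => x * z + th).
  (* [P'] is the integrand times [1 + x ^+ 2] up to a bounded error. *)
  pose P := (x \*: ((cst 4 - (@id R) ^+ 2) * s) - 2 \*: ((@id R) * c)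
    + 6 \*: (@id R)).
  pose p y := (x ^+ 2 * (4 - y ^+ 2) - 2) * c y + 6.
  pose f y := (1 + x ^+ 2) * ((4 - y ^+ 2) * c y).
  have -> : \int[lebesgue_measure]_(y in `[-2, 2])
      ((1 + x ^+ 2) * (parabola_cap y * cos (x * y + th))) =
      \int[lebesgue_measure]_(y in `[-2, 2]) f y.
    apply: eq_Rintegral => y /[!inE]/=; rewrite in_itv/= => hy.
    by rewrite parabola_capE.
  have cf : continuous f.
    have -> : f = (1 + x ^+ 2) \*: ((cst 4 - (@id R) ^+ 2) * c) by [].
    by apply: derivable_continuous_at => y; exact: ex_derive.
  have cp : continuous p.
    have -> : p = (x ^+ 2 \*: (cst 4 - (@id R) ^+ 2) - cst 2) * c + cst 6 by [].
    by apply: derivable_continuous_at => y; exact: ex_derive.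
  have dP y : is_derive y 1 P (p y).
    apply: is_derive_eq; rewrite /p !fctE /= /GRing.scale/= /c /s /=; ring.
  apply: le_trans (integral_itv_le_deriv _ cf cp dP _) _.
  - lra.
  - move=> y /andP[y1 y2]; rewrite /f /p.
    have c1 : c y <= 1 by exact: cos_le1.
    have c2 : -1 <= c y by exact: cos_geN1.
    rewrite -subr_ge0.
    have -> : (x ^+ 2 * (4 - y ^+ 2) - 2) * c y + 6
      - (1 + x ^+ 2) * ((4 - y ^+ 2) * c y) =
      (6 - y ^+ 2) * (1 - c y) + y ^+ 2 by ring.
    by rewrite addr_ge0 ?sqr_ge0// mulr_ge0 ?subr_ge0//; nra.
  (* At the endpoints the sine term carries the factor [4 - y^2 = 0]. The cosine terms contribute at
     most 8 and the linear term 24, whence 32. *)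
  - have := cos_le1 (x * 2 + th); have := cos_le1 (x * -2 + th).
    have := cos_geN1 (x * 2 + th); have := cos_geN1 (x * -2 + th).
    rewrite /P !fctE /= /GRing.scale/= /c /s /=; lra.
rewrite ler_norml pos// andbT lerNl.
rewrite -mulN1r -bm_integralZl//.
apply: le_trans (pos (theta + pi)); rewrite le_eqVlt; apply/orP; left.
by apply/eqP/eq_integralT => y; rewrite addrA cosDpi; ring.
Qed.

(** A primitive is [- atan (x - y)], so the mass stays below [pi], uniformly in [r] and [x]. This is
    the row sum in Schur's test. *)
Lemma integral_cauchy_le (r x : R) : 0 < r ->
  \int[leb_itv r]_y (1 + (x - y) ^+ 2)^-1 <= 4.
Proof.
move=> r0.
have den y : 0 < 1 + (x - y) ^+ 2 by rewrite ltr_pwDl// sqr_ge0.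
have cq : continuous (fun y => (1 + (x - y) ^+ 2)^-1).
  apply: derivable_continuous_at => y.
  by apply: derivableV; [rewrite gt_eqF|exact: ex_derive].
rewrite leb_itv_integral; last first.
  split; first exact: continuous_measurable_fun.
  exists 1 => y; rewrite normfV gtr0_norm// invf_le1//.
  by rewrite lerDl sqr_ge0.
have dP y : is_derive y 1 (- (atan \o (fun z => x - z)))
    (1 + (x - y) ^+ 2)^-1.
  have dd : is_derive y 1 (fun z => x - z) (-1).
    by apply: is_derive_eq; ring.
  have dc : is_derive y 1 (atan \o (fun z => x - z))
      ((1 + (x - y) ^+ 2)^-1 * -1).
    exact: (is_derive1_comp (g := fun z => x - z) (is_derive1_atan _) dd).
  by apply: is_derive_eq; ring.
rewrite (integral_itv_deriv _ cq dP)//; last lra.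
rewrite !fctE /= opprK addrC.
have := atan_gtNpi2 (x - r); have := atan_ltpi2 (x - - r).
by have := @pihalf_lt2 R; lra.
Qed.

End one_dimensional_kernels.

(** * Splitting off the first or the last coordinate of a tuple *)

Section tuple_functions.
Context {R : realType}.

Lemma bm_prod d (T : measurableType d) n (f : 'I_n -> T -> R) :
  (forall i, bounded_measurable (f i)) ->
  bounded_measurable (fun x => \prod_(i < n) f i x).
Proof.
elim: n f => [|n IH] f bf.
  by under eq_fun do rewrite big_ord0; exact: bm_cst.
by under eq_fun do rewrite big_ord_recl; apply: bmM => //; exact: IH.
Qed.

Lemma measurable_dotp d (T : measurableType d) n (f g : T -> n.-tuple R) :
  measurable_fun setT f -> measurable_fun setT g ->
  measurable_fun setT (fun x => dotp (f x) (g x)).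
Proof.
move=> mf mg; apply: measurable_sum => i; apply: measurable_funM.
  by apply: (measurableT_comp (measurable_tnth i) mf).
by apply: (measurableT_comp (measurable_tnth i) mg).
Qed.

Lemma tcons_thead_behead n (x : n.+1.-tuple R) :
  x = tcons (thead x, [tuple of behead x]).
Proof. by apply/val_inj; case/tupleP: x => a x /=; rewrite theadE. Qed.

Lemma tnth_tcons0 n (a : R) (x : n.-tuple R) : tnth (tcons (a, x)) ord0 = a.
Proof. by []. Qed.

Lemma tnth_tconsS n (a : R) (x : n.-tuple R) i :
  tnth (tcons (a, x)) (lift ord0 i) = tnth x i.
Proof. by rewrite tnthS. Qed.

Lemma dotp_tcons n (a b : R) (x y : n.-tuple R) :
  dotp (tcons (a, x)) (tcons (b, y)) = a * b + dotp x y.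
Proof.
rewrite /dotp big_ord_recl !tnth_tcons0; congr (_ + _).
by apply: eq_bigr => i _; rewrite !tnth_tconsS.
Qed.

Lemma prod_tcons n (f : R -> R) (a : R) (x : n.-tuple R) :
  \prod_(i < n.+1) f (tnth (tcons (a, x)) i) =
  f a * \prod_(i < n) f (tnth x i).
Proof.
rewrite big_ord_recl tnth_tcons0; congr (_ * _).
by apply: eq_bigr => i _; rewrite tnth_tconsS.
Qed.

Lemma prod2_tcons n (f : R -> R -> R) (a b : R) (x y : n.-tuple R) :
  \prod_(i < n.+1) f (tnth (tcons (a, x)) i) (tnth (tcons (b, y)) i) =
  f a b * \prod_(i < n) f (tnth x i) (tnth y i).
Proof.
rewrite big_ord_recl !tnth_tcons0; congr (_ * _).
by apply: eq_bigr => i _; rewrite !tnth_tconsS.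
Qed.

Definition trcons n (p : n.-tuple R * R) : n.+1.-tuple R :=
  [tuple of rcons p.1 p.2].

Lemma tnth_trcons n (x : n.-tuple R) t (i : 'I_n.+1) :
  tnth (trcons (x, t)) i = if (i < n)%N then nth 0 x i else t.
Proof.
rewrite (tnth_nth 0) /= nth_rcons size_tuple; case: ifPn => // ni.
by rewrite ifT// eqn_leq -ltnS ltn_ord leqNgt.
Qed.

Lemma measurable_trcons n : measurable_fun setT (@trcons n).
Proof.
apply/measurable_fun_tnthP => i.
have [ilt|ige] := boolP (i < n)%N.
  rewrite (_ : _ \o _ = fun p => tnth p.1 (Ordinal ilt)).
    exact: (measurableT_comp (measurable_tnth _) measurable_fst).
  by apply/funext => -[x t] /=; rewrite tnth_trcons ilt (tnth_nth 0).
rewrite (_ : _ \o _ = snd) //.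
by apply/funext => -[x t] /=; rewrite tnth_trcons (negbTE ige).
Qed.

(** Lebesgue measure is built by prepending coordinates, whereas time is the last one. The induction
    carries the last coordinate past the head by one use of Fubini. *)
Lemma leb_box_integral_trcons (r : R) n (F : n.+1.-tuple R -> R) :
  bounded_measurable F ->
  \int[leb_box r n.+1]_z F z =
  \int[leb_itv r]_t \int[leb_box r n]_x F (trcons (x, t)).
Proof.
elim: n F => [|n IH] F bF.
  rewrite leb_box_integralS//; apply: eq_integralT => a.
  by rewrite !leb_box0_integral; congr F; apply/val_inj.
rewrite leb_box_integralS//.
have e a t (x : n.-tuple R) :
    tcons (a, trcons (x, t)) = trcons (tcons (a, x), t).
  exact/val_inj.
have bG : bounded_measurable
    (fun q : R * R * n.-tuple R => F (trcons (tcons (q.1.1, q.2), q.1.2))).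
  apply: (bm_comp bF).
  apply: (measurableT_comp (measurable_trcons (n := n.+1)) (g := fun q =>
    (tcons (q.1.1, q.2), q.1.2))).
  apply/measurable_fun_pair => /=.
    apply: (measurableT_comp (@measurable_tcons R n) (g := fun q =>
      (q.1.1, q.2))).
    apply/measurable_fun_pair => //=; exact: measurableT_comp.
  exact: measurableT_comp.
transitivity (\int[leb_itv r]_a \int[leb_itv r]_t \int[leb_box r n]_x
    F (trcons (tcons (a, x), t))).
  apply: eq_integralT => a; rewrite IH; last first.
    exact: (bm_section1 (f := fun a y => F (tcons (a, y))) a (bm_tcons bF)).
  by do 2 apply: eq_integralT => ?; rewrite e.
rewrite (bm_fubini _ _ (f := fun a t =>
  \int[leb_box r n]_x F (trcons (tcons (a, x), t)))).
  apply: eq_integralT => t; rewrite leb_box_integralS//.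
  apply: (bm_comp bF).
  by apply: (measurableT_comp (measurable_trcons (n := n.+1)));
    exact: pair2_measurable.
exact: (bm_integral (leb_box r n) (f := fun (p : R * R) x =>
  F (trcons (tcons (p.1, x), p.2))) bG).
Qed.

End tuple_functions.

(** * Oscillatory integrals over cubes *)

Section tensor_estimates.
Context {R : realType}.

(** The integral of a product kernel factorizes, so the one-dimensional Schur bound is raised to the
    power [n]. *)
Lemma box_prod_integral_le (r C : R) (h : R -> R -> R) :
  (forall x, bounded_measurable (h x)) -> (forall x y, 0 <= h x y) ->
  (forall x, \int[leb_itv r]_y h x y <= C) ->
  forall n (x : n.-tuple R),
    \int[leb_box r n]_y \prod_(i < n) h (tnth x i) (tnth y i) <= C ^+ n.
Proof.
move=> bh h0 hC; elim=> [|n IH] x.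
  by rewrite leb_box0_integral big_ord0 expr0.
have bp m (z : m.-tuple R) : bounded_measurable
    (fun y : m.-tuple R => \prod_(i < m) h (tnth z i) (tnth y i)).
  apply: bm_prod => i; apply: bm_comp (bh _) _; exact: measurable_tnth.
rewrite leb_box_integralS// (tcons_thead_behead x).
set x0 := thead x; set x' := [tuple of behead x].
under eq_integralT do under eq_integralT do rewrite prod2_tcons.
under eq_integralT do rewrite bm_integralZl//.
rewrite bm_integralZr// exprS ler_pM//.
  by apply: bm_integral_ge0 => y.
by apply: bm_integral_ge0 => y; apply: prodr_ge0.
Qed.

Lemma integral_itv1_le_cap (G : R -> R) : bounded_measurable G ->
  (forall y, 0 <= G y) ->
  \int[leb_itv 1]_y G y <= 3^-1 * \int[leb_itv 2]_y (parabola_cap y * G y).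
Proof.
move=> bG G0.
have bbG : bounded_measurable (fun y => parabola_cap y * G y).
  by apply: bmM => //; exact: bm_parabola_cap.
rewrite -bm_integralZl// !leb_itv_integral//; last first.
  by apply: bmM => //; exact: bm_cst.
have sub : `[-1, 1]%classic `<=` `[-2, 2 : R]%classic.
  by move=> y /=; rewrite !in_itv/= => /andP[? ?]; apply/andP; split; lra.
rewrite -{1}(setIidr sub) Rintegral_mkcondr.
have fin : (lebesgue_measure `[(- 2)%R, 2%R : R]%classic < +oo)%E.
  by rewrite lebesgue_measure_itv/=; case: ifPn => //= _; rewrite -EFinB ltry.
have int (f : R -> R) : bounded_measurable f ->
    lebesgue_measure.-integrable `[-2, 2] (EFin \o f).
  move=> [mf [M fM]]; apply: measurable_bounded_integrable => //.
  - exact: measurable_funTS.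
  - by exists M; split; [exact: num_real|move=> N MN x _; exact: le_trans (ltW MN)].
apply: le_Rintegral => //.
- apply: int; rewrite patch_indic; apply: bmM => //; exact: bm_indic.
- by apply: int; apply: bmM => //; exact: bm_cst.
- move=> y /=; rewrite in_itv/= => y2; rewrite patchE; case: ifPn => y1.
    rewrite parabola_capE//; move: y1; rewrite inE/= in_itv/= => y1.
    rewrite mulrA ler_peMl//; nra.
  by rewrite mulr_ge0 ?invr_ge0// mulr_ge0 ?parabola_cap_ge0.
Qed.

(** One variable is treated at a time: the inner integral, already weighted, is itself a nonnegative
    bounded function of the head coordinate. *)
Lemma box1_integral_le_cap n (h : n.-tuple R -> R) :
  bounded_measurable h -> (forall y, 0 <= h y) ->
  \int[leb_box 1 n]_y h y <=
  (3 ^+ n)^-1 * \int[leb_box 2 n]_y (\prod_(i < n) parabola_cap (tnth y i) * h y).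
Proof.
have bW m : bounded_measurable
    (fun y : m.-tuple R => \prod_(i < m) parabola_cap (tnth y i)).
  by apply: bm_prod => i; apply: (bm_comp bm_parabola_cap); exact: measurable_tnth.
elim: n h => [|n IH] h bh h0.
  by rewrite !leb_box0_integral big_ord0 expr0 invr1 !mul1r.
have bWh : bounded_measurable
    (fun p : R * n.-tuple R => \prod_(i < n) parabola_cap (tnth p.2 i) *
      h (tcons (p.1, p.2))).
  apply: bmM; last exact: bm_tcons.
  exact: (bm_comp (bW n) measurable_snd).
rewrite !leb_box_integralS//; last by apply: bmM.
pose G a := \int[leb_box 2 n]_y (\prod_(i < n) parabola_cap (tnth y i) *
  h (tcons (a, y))).
have bG : bounded_measurable G.
  exact: (bm_integral (leb_box 2 n) (f := fun a y =>
    \prod_(i < n) parabola_cap (tnth y i) * h (tcons (a, y)))).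
have G0 a : 0 <= G a.
  by apply: bm_integral_ge0 => y; rewrite mulr_ge0// prodr_ge0// => i _;
    exact: parabola_cap_ge0.
have bs a : bounded_measurable (fun y => h (tcons (a, y))).
  exact: (bm_section1 (f := fun a y => h (tcons (a, y))) a (bm_tcons bh)).
apply: (@le_trans _ _ (\int[leb_itv 1]_a ((3 ^+ n)^-1 * G a))).
  apply: bm_le_integral.
  - exact: (bm_integral (leb_box 1 n) (bm_tcons bh)).
  - by apply: bmM => //; exact: bm_cst.
  - by move=> a; apply: IH.
rewrite bm_integralZl// exprS invfM -mulrA [leRHS]mulrCA.
rewrite ler_wpM2l ?invr_ge0 ?exprn_ge0//.
apply: (le_trans (integral_itv1_le_cap bG G0)).
rewrite ler_wpM2l ?invr_ge0// le_eqVlt; apply/orP; left; apply/eqP.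
apply: eq_integralT => a; rewrite -bm_integralZl.
  by apply: eq_integralT => y; rewrite prod_tcons mulrA.
by apply: bmM.
Qed.

(** The phase is a sum over coordinates, but the cosine of a sum is a difference of two products.
    Each coordinate therefore doubles the number of terms, which gives [2 ^+ n]; the sines are
    cosines shifted by [pi / 2], so the hypothesis and the induction must allow every [theta]. *)
Lemma oscillatory_tensor_le (r t : R) (g K : R -> R) :
  bounded_measurable g ->
  (forall x theta,
    `|\int[leb_itv r]_y (g y * cos (2 * pi * (x * y + t * y ^+ 2) + theta))|
      <= K x) ->
  forall n (x : n.-tuple R) theta,
    `|\int[leb_box r n]_y (\prod_(i < n) g (tnth y i) *
        cos (2 * pi * (dotp x y + t * dotp y y) + theta))|
    <= 2 ^+ n * \prod_(i < n) K (tnth x i).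
Proof.
move=> bg gK; elim=> [|n IH] x theta.
  rewrite leb_box0_integral !big_ord0 expr0 !mul1r.
  by rewrite ler_norml cos_geN1 cos_le1.
have mph m (z : m.-tuple R) th : measurable_fun setT
    (fun y : m.-tuple R => 2 * pi * (dotp z y + t * dotp y y) + th).
  apply: measurable_funD => //; apply: measurable_funM => //.
  apply: measurable_funD; first exact: measurable_dotp.
  by apply: measurable_funM => //; exact: measurable_dotp.
have bW m : bounded_measurable
    (fun y : m.-tuple R => \prod_(i < m) g (tnth y i)).
  by apply: bm_prod => i; apply: (bm_comp bg); exact: measurable_tnth.
rewrite leb_box_integralS; last by apply: bmM => //; apply: bm_cos; exact: mph.
rewrite (tcons_thead_behead x).
set x0 := thead x; set x' := [tuple of behead x].
pose al a := 2 * pi * (x0 * a + t * a ^+ 2).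
pose A th := \int[leb_box r n]_y (\prod_(i < n) g (tnth y i) *
        cos (2 * pi * (dotp x' y + t * dotp y y) + th)).
have mal : measurable_fun setT al.
  apply: measurable_funM => //; apply: measurable_funD.
    exact: measurable_funM.
  by apply: measurable_funM.
have bc th : bounded_measurable (fun a => g a * cos (al a + th)).
  by apply: bmM => //; apply: bm_cos; exact: measurable_funD.
have bA th : bounded_measurable (fun y : n.-tuple R =>
    \prod_(i < n) g (tnth y i) *
      cos (2 * pi * (dotp x' y + t * dotp y y) + th)).
  exact: bmM (bW n) (bm_cos (mph n x' th)).
have shift u : sin u = cos (u - pi / 2).
  by rewrite cosB cos_pihalf sin_pihalf mulr0 mulr1 add0r.
have -> : \int[leb_itv r]_a \int[leb_box r n]_y
    (\prod_(i < n.+1) g (tnth (tcons (a, y)) i) *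
     cos (2 * pi * (dotp (tcons (x0, x')) (tcons (a, y)) +
        t * dotp (tcons (a, y)) (tcons (a, y))) + theta)) =
   A theta * \int[leb_itv r]_a (g a * cos (al a + 0)) -
   A (theta - pi / 2) * \int[leb_itv r]_a (g a * cos (al a - pi / 2)).
  rewrite -!bm_integralZl// -bm_integralB; [|by apply: bmM => //; exact: bm_cst..].
  apply: eq_integralT => a.
  rewrite addr0 -shift !mulrA [_ * g a]mulrC -!mulrA [_ * (g a * _)]mulrCA.
  rewrite -mulrBr [A _ * _]mulrC [A _ * _]mulrC -!bm_integralZl//.
  rewrite -bm_integralB; [|by apply: bmM => //; exact: bm_cst..].
  rewrite -bm_integralZl; last first.
    by apply: bmB; apply: bmM => //; exact: bm_cst.
  apply: eq_integralT => y.
  rewrite prod_tcons !dotp_tcons addrA -shift.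
  have -> : 2 * pi * (x0 * a + dotp x' y + t * (a * a + dotp y y)) + theta =
     al a + (2 * pi * (dotp x' y + t * dotp y y) + theta).
    by rewrite /al; ring.
  by rewrite cosD; ring.
have K0 z : 0 <= K z by apply: le_trans (gK z 0).
rewrite prod_tcons exprS.
have -> : 2 * 2 ^+ n * (K x0 * \prod_(i < n) K (tnth x' i)) =
  (2 ^+ n * \prod_(i < n) K (tnth x' i)) * K x0 +
  (2 ^+ n * \prod_(i < n) K (tnth x' i)) * K x0 by ring.
apply: le_trans (ler_normB _ _) _; rewrite !normrM.
by apply: lerD; apply: ler_pM => //; [exact: IH|exact: gK|exact: IH|exact: gK].
Qed.

End tensor_estimates.

(** * Near and far interactions of time slices *)

Section correlations.
Context {R : realType}.

Definition tsub n (x y : n.-tuple R) : n.-tuple R :=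
  [tuple tnth x i - tnth y i | i < n].

Lemma dotp_tsub n (x x' y : n.-tuple R) :
  dotp (tsub x x') y = dotp x y - dotp x' y.
Proof.
rewrite /dotp -sumrB; apply: eq_bigr => i _.
by rewrite tnth_mktuple mulrBl.
Qed.

Lemma measurable_tsub d (T : measurableType d) n (f g : T -> n.-tuple R) :
  measurable_fun setT f -> measurable_fun setT g ->
  measurable_fun setT (fun p => tsub (f p) (g p)).
Proof.
move=> mf mg; apply/measurable_fun_tnthP => i.
rewrite (_ : _ \o _ = fun p => tnth (f p) i - tnth (g p) i); last first.
  by apply/funext => p /=; rewrite tnth_mktuple.
apply: measurable_funB.
  exact: (measurableT_comp (measurable_tnth i) mf).
exact: (measurableT_comp (measurable_tnth i) mg).
Qed.

(** This is [2 pi] times the scalar product of the space-time point [(x, t)] with the point of the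
    paraboloid above [y]; see [dotp_lift_paraboloid]. *)
Definition phase n (x : n.-tuple R) (t : R) (y : n.-tuple R) : R :=
  2 * pi * (dotp x y + t * dotp y y).

Lemma phase_tsub n (x x' y : n.-tuple R) t s :
  phase (tsub x x') (t - s) y = phase x t y - phase x' s y.
Proof. by rewrite /phase dotp_tsub; ring. Qed.

Lemma measurable_phase d (T : measurableType d) n (f g : T -> n.-tuple R)
    (t : T -> R) :
  measurable_fun setT f -> measurable_fun setT g -> measurable_fun setT t ->
  measurable_fun setT (fun p => phase (f p) (t p) (g p)).
Proof.
move=> mf mg mt; apply: measurable_funM => //; apply: measurable_funD.
  exact: measurable_dotp.
by apply: measurable_funM => //; exact: measurable_dotp.
Qed.

Section kernel.
Variable n : nat.
Variables (mu nu : {finite_measure set (n.-tuple R) -> \bar R}).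

(** With [sin_transform], the real and imaginary parts of the integral of [f] against [e^(i phase)]:
    a Fourier transform in space, multiplied by the Schroedinger factor [e^(2 pi i t |y|^2)]. *)
Definition cos_transform (f : n.-tuple R -> R) t y :=
  \int[mu]_x (f x * cos (phase x t y)).

Definition sin_transform (f : n.-tuple R -> R) t y :=
  \int[mu]_x (f x * sin (phase x t y)).

Lemma bm_mul_cos_phase (f : n.-tuple R -> R) t y : bounded_measurable f ->
  bounded_measurable (fun x => f x * cos (phase x t y)).
Proof. by move=> bf; apply: bmM => //; apply: bm_cos; exact: measurable_phase. Qed.

Lemma bm_mul_sin_phase (f : n.-tuple R -> R) t y : bounded_measurable f ->
  bounded_measurable (fun x => f x * sin (phase x t y)).
Proof. by move=> bf; apply: bmM => //; apply: bm_sin; exact: measurable_phase. Qed.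

(** The left side is the real part of one transform times the conjugate of the other. As the phase
    is linear in [(x, t)], the product depends only on the differences [x - x'] and [t - s]. *)
Lemma correlation_expand (f g : n.-tuple R -> R) t s y :
  bounded_measurable f -> bounded_measurable g ->
  cos_transform f t y * cos_transform g s y +
  sin_transform f t y * sin_transform g s y =
  \int[mu]_x \int[mu]_x' (f x * g x' * cos (phase (tsub x x') (t - s) y)).
Proof.
move=> bf bg.
have [bfc bfs] := (bm_mul_cos_phase t y bf, bm_mul_sin_phase t y bf).
have [bgc bgs] := (bm_mul_cos_phase s y bg, bm_mul_sin_phase s y bg).
rewrite /cos_transform /sin_transform.
rewrite -!bm_integralZr// -bm_integralD; [|by apply: bmM => //; exact: bm_cst..].
apply: eq_integralT => x; rewrite -!bm_integralZl//.
rewrite -bm_integralD; [|by apply: bmM => //; exact: bm_cst..].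
by apply: eq_integralT => x'; rewrite phase_tsub cosB; ring.
Qed.

(** The weight [w] is 1 for distant slices and a product of caps for near ones. The summand [0]
    gives the kernel the shape of [oscillatory_tensor_le] with [theta = 0]. *)
Lemma correlation_kernel (w f g : n.-tuple R -> R) t s :
  bounded_measurable w -> bounded_measurable f -> bounded_measurable g ->
  \int[nu]_y (w y * (cos_transform f t y * cos_transform g s y +
                     sin_transform f t y * sin_transform g s y)) =
  \int[mu]_x \int[mu]_x' (f x * g x' *
    \int[nu]_y (w y * cos (phase (tsub x x') (t - s) y + 0))).
Proof.
move=> bw bf bg; pose T := n.-tuple R.
pose G (y x x' : T) := w y * (f x * g x' * cos (phase (tsub x x') (t - s) y)).
have bG : bounded_measurable (fun p : T * T * T => G p.1.1 p.1.2 p.2).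
  have m11 : measurable_fun setT (fun p : T * T * T => p.1.1).
    exact: measurableT_comp.
  have m12 : measurable_fun setT (fun p : T * T * T => p.1.2).
    exact: measurableT_comp.
  apply: bmM; first exact: bm_comp bw m11.
  apply: bmM; first by apply: bmM; [exact: bm_comp bf m12|exact: bm_comp].
  by apply: bm_cos; apply: measurable_phase => //; exact: measurable_tsub.
have bG1 y : bounded_measurable (fun p => G y p.1 p.2).
  have : measurable_fun setT (fun p : T * T => ((y, p.1), p.2)).
    by apply: measurable_fun_pair => //; exact: measurable_fun_pair.
  exact: bm_comp bG.
have bG2 x : bounded_measurable (fun p => G p.1 x p.2).
  have : measurable_fun setT (fun p : T * T => ((p.1, x), p.2)).
    by apply: measurable_fun_pair => //; exact: measurable_fun_pair.
  exact: bm_comp bG.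
have bH y : bounded_measurable
    (fun p : T * T => f p.1 * g p.2 * cos (phase (tsub p.1 p.2) (t - s) y)).
  apply: bmM; first by apply: bmM; exact: bm_comp.
  by apply: bm_cos; apply: measurable_phase => //; exact: measurable_tsub.
transitivity (\int[nu]_y \int[mu]_x \int[mu]_x' G y x x').
  apply: eq_integralT => y; rewrite correlation_expand// -bm_integralZl.
    apply: eq_integralT => x; rewrite -bm_integralZl//.
    exact: (bm_section1 (f := fun x x' =>
      f x * g x' * cos (phase (tsub x x') (t - s) y)) x (bH y)).
  exact: (bm_integral mu (bH y)).
rewrite (bm_fubini nu mu (f := fun y x => \int[mu]_x' G y x x')); last first.
  exact: (bm_integral mu (f := fun (p : T * T) x' => G p.1 p.2 x')).
apply: eq_integralT => x; rewrite (bm_fubini nu mu (f := fun y x' => G y x x'))//.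
apply: eq_integralT => x'; rewrite -bm_integralZl; last first.
  by apply: bmM => //; apply: bm_cos; apply: measurable_funD => //;
    exact: measurable_phase.
by apply: eq_integralT => y; rewrite /G addr0; ring.
Qed.

Lemma bm_kernel_phase (w : n.-tuple R -> R) t : bounded_measurable w ->
  bounded_measurable (fun p : n.-tuple R * n.-tuple R =>
    \int[nu]_y (w y * cos (phase (tsub p.1 p.2) t y + 0))).
Proof.
move=> bw; pose T := n.-tuple R.
apply: (bm_integral nu (f := fun (p : T * T) y =>
  w y * cos (phase (tsub p.1 p.2) t y + 0))).
apply: bmM; first exact: bm_comp bw measurable_snd.
apply: bm_cos; apply: measurable_funD => //; apply: measurable_phase => //.
by apply: measurable_tsub; exact: measurableT_comp.
Qed.

End kernel.

Section slices.
Variable n : nat.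
Variable M : R.
Hypothesis M0 : 0 < M.
Let mu := leb_box M n.

(** A dispersive estimate: the kernel is bounded uniformly in [x - x'], and the masses of [f] and
    [g] factor out. In each coordinate 14 is the van der Corput constant 7 times the 2 lost in
    [oscillatory_tensor_le]. *)
Lemma correlation_far (f g : n.-tuple R -> R) t s :
  bounded_measurable f -> bounded_measurable g ->
  (forall x, 0 <= f x) -> (forall x, 0 <= g x) -> t != s ->
  \int[leb_box 1 n]_y (cos_transform mu f t y * cos_transform mu g s y +
                     sin_transform mu f t y * sin_transform mu g s y) <=
  (14 / Num.sqrt `|t - s|) ^+ n * \int[mu]_x f x * \int[mu]_x g x.
Proof.
move=> bf bg f0 g0 ts.
have b1 : bounded_measurable (fun _ : n.-tuple R => 1 : R) by exact: bm_cst.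
have := correlation_kernel mu (leb_box 1 n) t s b1 bf bg.
under eq_integralT do rewrite mul1r.
move=> ->; set B := (14 / _) ^+ n.
have ts0 : 0 < Num.sqrt `|t - s| by rewrite sqrtr_gt0 normr_gt0 subr_eq0.
have kB x : `|\int[leb_box 1 n]_y (1 * cos (phase x (t - s) y + 0))| <= B.
  have h1 (a th : R) : `|\int[leb_itv 1]_y ((fun=> 1) y *
      cos (2 * pi * (a * y + (t - s) * y ^+ 2) + th))| <=
      (fun=> 7 / Num.sqrt `|t - s|) a.
    rewrite (eq_integralT (fun y =>
      cos (2 * pi * a * y + 2 * pi * (t - s) * y ^+ 2 + th))); last first.
      by move=> y; rewrite mul1r; congr cos; ring.
    have pi2 : 1 <= 2 * pi :> R by have := @pi_ge2 R; lra.
    have d0 : 2 * pi * (t - s) != 0.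
      by rewrite mulf_neq0 ?subr_eq0// gt_eqF//; lra.
    apply: le_trans (vdc_quadratic (2 * pi * a) th d0) _.
    rewrite ler_pM2l// lef_pV2 ?posrE//; last first.
      by rewrite sqrtr_gt0 normr_gt0.
    rewrite ler_wsqrtr// normrM ger0_norm; last lra.
    by rewrite ler_peMl.
  have := oscillatory_tensor_le (bm_cst R 1) h1 x 0.
  have pK : \prod_(i < n) (7 / Num.sqrt `|t - s|) = (7 / Num.sqrt `|t - s|) ^+ n.
    by rewrite prodr_const card_ord.
  rewrite /= pK -exprMn.
  rewrite (_ : 2 * (7 / Num.sqrt `|t - s|) = 14 / Num.sqrt `|t - s|);
    last by field; rewrite gt_eqF.
  apply: le_trans; rewrite le_eqVlt; apply/orP; left; apply/eqP.
  by congr (`| _ |); apply: eq_integralT => y; rewrite prodr_const expr1n.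
have bk := bm_kernel_phase (leb_box 1 n) (t - s) b1.
have bfg : bounded_measurable (fun p : n.-tuple R * n.-tuple R => f p.1 * g p.2).
  by apply: bmM; exact: bm_comp.
pose G x x' := f x * g x' *
  \int[leb_box 1 n]_y (1 * cos (phase (tsub x x') (t - s) y + 0)).
have bG : bounded_measurable (fun p => G p.1 p.2) by exact: bmM bfg bk.
apply: (@le_trans _ _ (\int[mu]_x \int[mu]_x' (B * f x * g x'))).
  apply: bm_le_integral.
  - exact: (bm_integral mu bG).
  - apply: (bm_integral mu (f := fun x x' => B * f x * g x')).
    apply: bmM; last exact: (bm_comp bg measurable_snd).
    by apply: bmM; [exact: bm_cst|exact: (bm_comp bf measurable_fst)].
  - move=> x; apply: bm_le_integral.
    + exact: (bm_section1 x bG).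
    + by apply: bmM => //; exact: bm_cst.
    + move=> x'; rewrite /G -[leRHS]mulrA mulrC ler_wpM2r ?mulr_ge0//.
      exact: le_trans (ler_norm _) (kB _).
under eq_integralT do rewrite bm_integralZl//.
rewrite bm_integralZr; last by apply: bmM => //; exact: bm_cst.
by rewrite bm_integralZl.
Qed.

(* A Bessel inequality: the sharp cube is dominated by the tensor power of
   [parabola_cap], and Schur's test applies to the resulting kernel. *)
Lemma correlation_near (f : n.-tuple R -> R) t :
  bounded_measurable f -> (forall x, 0 <= f x <= 1) ->
  \int[leb_box 1 n]_y (cos_transform mu f t y ^+ 2 +
                     sin_transform mu f t y ^+ 2) <=
  256 ^+ n * \int[mu]_x f x.
Proof.
move=> bf f01.
have f0 x : 0 <= f x by case/andP: (f01 x).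
have bcs : bounded_measurable (fun y =>
    cos_transform mu f t y ^+ 2 + sin_transform mu f t y ^+ 2).
  apply: bmD; apply: bmX.
    apply: (bm_integral mu (f := fun y x => f x * cos (phase x t y))).
    apply: bmM; first exact: bm_comp.
    by apply: bm_cos; exact: measurable_phase.
  apply: (bm_integral mu (f := fun y x => f x * sin (phase x t y))).
  apply: bmM; first exact: bm_comp.
  by apply: bm_sin; exact: measurable_phase.
apply: le_trans (box1_integral_le_cap bcs _) _.
  by move=> y; rewrite addr_ge0 ?sqr_ge0.
pose W (y : n.-tuple R) := \prod_(i < n) parabola_cap (tnth y i).
have bW : bounded_measurable W.
  by apply: bm_prod => i; apply: (bm_comp bm_parabola_cap); exact: measurable_tnth.
have := correlation_kernel mu (leb_box 2 n) t t bW bf bf.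
under eq_integralT do rewrite -!expr2.
move=> ->.
pose h (a b : R) := (1 + (a - b) ^+ 2)^-1.
have h0 a b : 0 <= h a b by rewrite invr_ge0 addr_ge0 ?sqr_ge0.
have bh : bounded_measurable (fun p : R * R => h p.1 p.2).
  split.
    apply: (measurableT_comp (f := fun u : R => (1 + u ^+ 2)^-1)
      (g := fun p : R * R => p.1 - p.2)).
      apply: continuous_measurable_fun.
      apply: derivable_continuous_at => y; apply: derivableV.
        by rewrite gt_eqF// ltr_pwDl// sqr_ge0.
      exact: ex_derive.
    exact: measurable_funB.
  exists 1 => p; rewrite normfV gtr0_norm ?invf_le1 ?ltr_pwDl ?sqr_ge0//.
  by rewrite lerDl sqr_ge0.
have kB x x' : \int[leb_box 2 n]_y (W y * cos (phase (tsub x x') (t - t) y + 0))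
    <= 64 ^+ n * \prod_(i < n) h (tnth x i) (tnth x' i).
  (* At equal times the quadratic phase vanishes and only the transform of the cap remains;
     [2 * pi >= 1] allows the frequency [2 * pi * a] to be replaced by [a]. With the factor 2 per
     coordinate, 32 becomes 64. *)
  have h1 (a th : R) : `|\int[leb_itv 2]_y (parabola_cap y *
      cos (2 * pi * (a * y + (t - t) * y ^+ 2) + th))| <=
      32 / (1 + a ^+ 2).
    rewrite (eq_integralT (fun y =>
      parabola_cap y * cos (2 * pi * a * y + th))); last first.
      by move=> y; rewrite subrr mul0r addr0 mulrA.
    apply: le_trans (integral_parabola_cap_cos _ _) _.
    rewrite ler_pM2l// lef_pV2 ?posrE ?ltr_pwDl ?sqr_ge0// lerD2l.
    rewrite exprMn ler_peMl ?sqr_ge0//.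
    by have := @pi_ge2 R; nra.
  apply: le_trans (ler_norm _) _.
  apply: le_trans (oscillatory_tensor_le bm_parabola_cap h1 (tsub x x') 0) _.
  rewrite le_eqVlt; apply/orP; left; apply/eqP.
  rewrite big_split/= prodr_const card_ord mulrA -exprMn -natrM; congr (_ * _).
  by apply: eq_bigr => i _; rewrite tnth_mktuple.
have bP : bounded_measurable (fun p : n.-tuple R * n.-tuple R =>
    \prod_(i < n) h (tnth p.1 i) (tnth p.2 i)).
  apply: bm_prod => i.
  apply: (bm_comp bh (g := fun p : n.-tuple R * n.-tuple R =>
    (tnth p.1 i, tnth p.2 i))).
  apply: measurable_fun_pair.
    exact: (measurableT_comp (measurable_tnth _) measurable_fst).
  exact: (measurableT_comp (measurable_tnth _) measurable_snd).
have bk := bm_kernel_phase (leb_box 2 n) (t - t) bW.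
have bff : bounded_measurable (fun p : n.-tuple R * n.-tuple R => f p.1 * f p.2).
  by apply: bmM; exact: bm_comp.
pose G x x' := f x * f x' *
  \int[leb_box 2 n]_y (W y * cos (phase (tsub x x') (t - t) y + 0)).
have bG : bounded_measurable (fun p => G p.1 p.2) by exact: bmM bff bk.
have bfP : bounded_measurable (fun p : n.-tuple R * n.-tuple R =>
    64 ^+ n * f p.1 * \prod_(i < n) h (tnth p.1 i) (tnth p.2 i)).
  by apply: bmM => //; apply: bmM; [exact: bm_cst|exact: bm_comp].
have P0 x x' : 0 <= \prod_(i < n) h (tnth x i) (tnth x' i) :> R.
  by apply: prodr_ge0.
apply: (@le_trans _ _ ((3 ^+ n)^-1 * (64 ^+ n * 4 ^+ n * \int[mu]_x f x))).
  rewrite ler_wpM2l ?invr_ge0 ?exprn_ge0//.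
  apply: (@le_trans _ _ (\int[mu]_x (64 ^+ n * 4 ^+ n * f x))); last first.
    by rewrite bm_integralZl.
  apply: bm_le_integral.
  - exact: (bm_integral mu bG).

  - by apply: bmM => //; exact: bm_cst.
  move=> x.
  (* Only [f x'] is bounded by 1 and [f x] is kept, so the final bound is linear in the mass of [f],
     as befits an indicator function. *)
  apply: (@le_trans _ _ (\int[mu]_x' (64 ^+ n * f x *
      \prod_(i < n) h (tnth x i) (tnth x' i)))).
    apply: bm_le_integral.
    + exact: (bm_section1 x bG).
    + exact: (bm_section1 (f := fun x x' =>
        64 ^+ n * f x * \prod_(i < n) h (tnth x i) (tnth x' i)) x bfP).
    + move=> x'; apply: le_trans (ler_wpM2l _ (kB x x')) _.
        by rewrite mulr_ge0.
      rewrite mulrCA -!mulrA ler_wpM2l ?exprn_ge0// ler_wpM2l//.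
      by rewrite ler_piMl//; case/andP: (f01 x').
  rewrite bm_integralZl; last first.
    exact: (bm_section1 (f := fun x x' =>
      \prod_(i < n) h (tnth x i) (tnth x' i)) x bP).
  rewrite mulrAC ler_wpM2r// ler_wpM2l ?exprn_ge0//.
  apply: box_prod_integral_le => //.
  - by move=> a; exact: (bm_section1 a bh).
  - by move=> a; exact: integral_cauchy_le.
(* Here 256 is 64 from the kernel times 4 from the row sum; the gain [3 ^- n] from the cap is
   discarded. *)
rewrite -exprMn -natrM mulrA ler_wpM2r//; first exact: bm_integral_ge0.
by rewrite ler_piMl ?exprn_ge0// invf_le1 ?exprn_gt0// exprn_ege1// ler1n.
Qed.

End slices.
End correlations.

(** * Energy on the paraboloid of the transform of a truncated set *)

Section slab_decomposition.
Context {R : realType}.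

Lemma dotp_ge0 n (x : n.-tuple R) : 0 <= dotp x x.
Proof. by apply: sumr_ge0 => i _; rewrite -expr2 sqr_ge0. Qed.

Lemma enorm_sqr n (x : n.-tuple R) : enorm x ^+ 2 = dotp x x.
Proof. by rewrite sqr_sqrtr// dotp_ge0. Qed.

Lemma dotp_lift_paraboloid n (x y : n.-tuple R) t :
  dotp (trcons (x, t)) (lift_paraboloid (n := n.+1) y) =
  dotp x y + t * dotp y y.
Proof.
rewrite /dotp big_ord_recr /=; congr (_ + _).
  apply: eq_bigr => i _; rewrite tnth_mktuple tnth_trcons /= ltn_ord.
  by rewrite !(tnth_nth 0).
by rewrite tnth_mktuple tnth_trcons /= ltnn enorm_sqr.
Qed.

Lemma integral_near_le (M rho t : R) : 0 < M -> 0 < rho ->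
  \int[leb_itv M]_s \1_[set s | `|t - s| < rho] s <= 2 * rho.
Proof.
move=> M0 rho0; rewrite /Rintegral.
have -> : [set s | `|t - s| < rho] = `]t - rho, t + rho[%classic.
  apply/seteqP; split => s /=; rewrite in_itv/= distrC ltr_distl//.
rewrite integral_indic// setIT.
apply: (@le_trans _ _ (fine (lebesgue_measure `](t - rho)%R, (t + rho)%R[%classic))).
  apply: fine_le.
  - exact: fin_num_measure.
  - by rewrite lebesgue_measure_itv/=; case: ifPn => // _; rewrite -EFinB.
  - by rewrite /= /leb_itv; apply: le_measure; rewrite ?inE//; exact: measurableI.
rewrite lebesgue_measure_itv/= lte_fin; case: ifPn => _; last by rewrite /= mulr_ge0 ?ltW.
by rewrite -EFinB /=; lra.
Qed.

Variable n : nat.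
Variable M : R.
Hypothesis M0 : 0 < M.
Variable E : set (n.+1.-tuple R).
Hypothesis mE : measurable E.

Let mu := leb_box M n.
Let e (t : R) (x : n.-tuple R) : R := \1_E (trcons (x, t)).

Let be : bounded_measurable (fun p : R * n.-tuple R => e p.1 p.2).
Proof.
apply: (bm_comp (bm_indic R mE)).
apply: (measurableT_comp (measurable_trcons (n := n))
  (g := fun p : R * n.-tuple R => (p.2, p.1))).
exact: measurable_fun_pair.
Qed.

Let e01 t x : 0 <= e t x <= 1.
Proof. by rewrite /e indicE; case: (_ \in _); rewrite /= lexx ler01. Qed.

Let e0 t x : 0 <= e t x.
Proof. by case/andP: (e01 t x). Qed.

Let bet t : bounded_measurable (e t).
Proof. exact: (bm_section1 (f := e) t be). Qed.

Let m t := \int[mu]_x e t x.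

Let bm_m : bounded_measurable m.
Proof. exact: (bm_integral mu (f := e)). Qed.

Let m0 t : 0 <= m t.
Proof. exact: bm_integral_ge0. Qed.

Let cc t y := cos_transform mu (e t) t y.
Let ss t y := sin_transform mu (e t) t y.

Let bcc : bounded_measurable (fun p : R * n.-tuple R => cc p.1 p.2).
Proof.
apply: (bm_integral mu (f := fun (p : R * n.-tuple R) x =>
  e p.1 x * cos (phase x p.1 p.2))).
apply: bmM.
  apply: (bm_comp be (g := fun p : R * n.-tuple R * n.-tuple R =>
    (p.1.1, p.2))).
  by apply: measurable_fun_pair => //; exact: measurableT_comp.
by apply: bm_cos; apply: measurable_phase => //; exact: measurableT_comp.
Qed.

Let bss : bounded_measurable (fun p : R * n.-tuple R => ss p.1 p.2).
Proof.
apply: (bm_integral mu (f := fun (p : R * n.-tuple R) x =>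
  e p.1 x * sin (phase x p.1 p.2))).
apply: bmM.
  apply: (bm_comp be (g := fun p : R * n.-tuple R * n.-tuple R =>
    (p.1.1, p.2))).
  by apply: measurable_fun_pair => //; exact: measurableT_comp.
by apply: bm_sin; apply: measurable_phase => //; exact: measurableT_comp.
Qed.

Let q t s := \int[leb_box 1 n]_y (cc t y * cc s y + ss t y * ss s y).

Let b t := \int[leb_box 1 n]_y (cc t y ^+ 2 + ss t y ^+ 2).


(** The transform is that of [E] cut to the box of half-side [M]; the cut is hidden in
    [leb_box M]. *)
Definition cos_hat (xi : n.+1.-tuple R) : R :=
  \int[leb_box M n.+1]_z (\1_E z * cos (2 * pi * dotp z xi)).

Definition sin_hat (xi : n.+1.-tuple R) : R :=
  \int[leb_box M n.+1]_z (\1_E z * sin (2 * pi * dotp z xi)).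

Let cos_hatE y : cos_hat (lift_paraboloid (n := n.+1) y) = \int[leb_itv M]_t cc t y.
Proof.
rewrite /cos_hat leb_box_integral_trcons; last first.
  apply: bmM; first exact: bm_indic.
  by apply: bm_cos; apply: measurable_funM => //; exact: measurable_dotp.
apply: eq_integralT => t; apply: eq_integralT => x.
by rewrite dotp_lift_paraboloid.
Qed.

Let sin_hatE y : sin_hat (lift_paraboloid (n := n.+1) y) = \int[leb_itv M]_t ss t y.
Proof.
rewrite /sin_hat leb_box_integral_trcons; last first.
  apply: bmM; first exact: bm_indic.
  by apply: bm_sin; apply: measurable_funM => //; exact: measurable_dotp.
apply: eq_integralT => t; apply: eq_integralT => x.
by rewrite dotp_lift_paraboloid.
Qed.

Let bm_corr : bounded_measurable (fun p : n.-tuple R * R * R =>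
  cc p.1.2 p.1.1 * cc p.2 p.1.1 + ss p.1.2 p.1.1 * ss p.2 p.1.1).
Proof.
have h1 : measurable_fun setT (fun p : n.-tuple R * R * R => (p.1.2, p.1.1)).
  by apply: measurable_fun_pair; exact: measurableT_comp.
have h2 : measurable_fun setT (fun p : n.-tuple R * R * R => (p.2, p.1.1)).
  by apply: measurable_fun_pair => //; exact: measurableT_comp.
apply: bmD; apply: bmM.
- exact: bm_comp bcc h1.
- exact: bm_comp bcc h2.
- exact: bm_comp bss h1.
- exact: bm_comp bss h2.
Qed.

Let bc t : bounded_measurable (cc t).
Proof. exact: (bm_section1 (f := cc) t bcc). Qed.

Let bs t : bounded_measurable (ss t).
Proof. exact: (bm_section1 (f := ss) t bss). Qed.

Let bc2 y : bounded_measurable (cc ^~ y).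
Proof. exact: (bm_section2 (f := cc) y bcc). Qed.

Let bs2 y : bounded_measurable (ss ^~ y).
Proof. exact: (bm_section2 (f := ss) y bss). Qed.

(** On the paraboloid the full transform is the time integral of the slice transforms. Its square is
    a double time integral, and Fubini moves the integral over the base cube inside. *)
Lemma hat_sqr_correlation :
  \int[leb_box 1 n]_y (cos_hat (lift_paraboloid (n := n.+1) y) ^+ 2
                     + sin_hat (lift_paraboloid (n := n.+1) y) ^+ 2) =
  \int[leb_itv M]_t \int[leb_itv M]_s q t s.
Proof.
pose G y t s := cc t y * cc s y + ss t y * ss s y.
transitivity (\int[leb_box 1 n]_y \int[leb_itv M]_t \int[leb_itv M]_s G y t s).
  apply: eq_integralT => y; rewrite cos_hatE sin_hatE !expr2.
  rewrite -!bm_integralZr// -bm_integralD; [|by apply: bmM => //; exact: bm_cst..].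
  apply: eq_integralT => t; rewrite -!bm_integralZl//.
  by rewrite -bm_integralD//; apply: bmM => //; exact: bm_cst.
rewrite (bm_fubini _ _ (f := fun y t => \int[leb_itv M]_s G y t s)); last first.
  exact: (bm_integral (leb_itv M) (f := fun (p : n.-tuple R * R) s =>
    G p.1 p.2 s)).
apply: eq_integralT => t.
rewrite (bm_fubini _ _ (f := fun y s => G y t s))//.
apply: (bm_comp bm_corr (g := fun p : n.-tuple R * R => ((p.1, t), p.2))).
by apply: measurable_fun_pair => //; exact: measurable_fun_pair.
Qed.

Lemma hat_sqr_le (rho : R) : 0 < rho ->
  \int[leb_box 1 n]_y (cos_hat (lift_paraboloid (n := n.+1) y) ^+ 2
                     + sin_hat (lift_paraboloid (n := n.+1) y) ^+ 2) <=
  2 * rho * 256 ^+ n * (\int[leb_box M n.+1]_z \1_E z) +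
  (14 / Num.sqrt rho) ^+ n * (\int[leb_box M n.+1]_z \1_E z) ^+ 2.
Proof.
move=> rho0.
pose near (t s : R) : R := \1_[set s | `|t - s| < rho] s.
have near0 t s : 0 <= near t s by rewrite /near indicE; case: (_ \in _).
have nearC t s : near t s = near s t.
  rewrite /near !indicE.
  rewrite (_ : (s \in _) = (t \in [set t | `|s - t| < rho]))//.
  by apply/idP/idP; rewrite !inE/= distrC.
have bnear : bounded_measurable (fun p : R * R => near p.1 p.2).
  have mN : measurable [set p : R * R | `|p.1 - p.2| < rho].
    rewrite (_ : [set _ | _] = (fun p : R * R => `|p.1 - p.2|) @^-1` `]-oo, rho[).
      rewrite -[X in measurable X]setTI.
      have : measurable_fun setT (fun p : R * R => `|p.1 - p.2|).
        by apply: measurableT_comp => //; exact: measurable_funB.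
      by apply.
    by apply/seteqP; split => p /=; rewrite in_itv.
  rewrite (_ : (fun p => near p.1 p.2) =
    \1_[set p : R * R | `|p.1 - p.2| < rho]); first exact: bm_indic.
  apply/funext => p; rewrite /near !indicE.
  by congr (_%:R); apply/idP/idP; rewrite !inE.
have near1 t s : `|t - s| < rho -> near t s = 1.
  by move=> ts; rewrite /near indicE mem_set.
have nearN t s : rho <= `|t - s| -> near t s = 0.
  move=> ts.
  by rewrite /near indicE memNset//= => /(le_lt_trans ts); rewrite ltxx.
have near_int t : \int[leb_itv M]_s near t s <= 2 * rho.
  exact: integral_near_le.
clearbody near.
have bmtt : bounded_measurable (fun p : R * R => m p.1).
  exact: (bm_comp bm_m measurable_fst).
have bmss : bounded_measurable (fun p : R * R => m p.2).
  exact: (bm_comp bm_m measurable_snd).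
have [C1 C1E] : exists c : R, c = 256 ^+ n by exists (256 ^+ n).
have [C2 C2E] : exists c : R, c = (14 / Num.sqrt rho) ^+ n.
  by exists ((14 / Num.sqrt rho) ^+ n).
have C10 : 0 <= C1 by rewrite C1E; exact: exprn_ge0 (ler0n _ _).
have C20 : 0 <= C2 by rewrite C2E exprn_ge0// divr_ge0 ?sqrtr_ge0// ler0n.
rewrite -C1E -C2E.
(* One bound serves all pairs of times: only the near term is masked, while the nonnegative far term
   may be added everywhere. *)
have qle t s : q t s <= (C1 / 2) * (near t s * (m t + m s)) + C2 * (m t * m s).
  have [ts|ts] := ltP `|t - s| rho.
    rewrite near1//.
    apply: (@le_trans _ _ (C1 / 2 * (m t + m s))); last first.
      by rewrite mul1r lerDl mulr_ge0// mulr_ge0.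
    (* Using [2 a b <= a^2 + b^2] pointwise reduces the correlation to its two diagonal values, to
       which Bessel applies; the outcome is linear in [m t] and [m s] and free of square roots. *)
    apply: (@le_trans _ _ ((b t + b s) / 2)).
      rewrite mulrC /b /q.
      have bq u : bounded_measurable (fun y => cc u y ^+ 2 + ss u y ^+ 2).
        by apply: bmD; exact: bmX.
      rewrite -bm_integralD// -bm_integralZl; last exact: bmD.
      apply: bm_le_integral.
      - by apply: bmD; exact: bmM.
      - by apply: bmM; [exact: bm_cst|exact: bmD].
      - move=> y; have := sqr_ge0 (cc t y - cc s y).
        have := sqr_ge0 (ss t y - ss s y); nra.
    rewrite -mulrA [2^-1 * _]mulrC mulrA ler_wpM2r ?invr_ge0// mulrDr.
    by rewrite C1E; apply: lerD; exact: correlation_near.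
  rewrite nearN// mul0r mulr0 add0r.
  have ts0 : 0 < `|t - s| by exact: lt_le_trans ts.
  have tns : t != s by rewrite -subr_eq0 -normr_gt0.
  apply: le_trans (correlation_far M (bet t) (bet s) (e0 t) (e0 s) tns) _.
  rewrite -[leLHS]mulrA ler_wpM2r ?mulr_ge0 ?(m0 t) ?(m0 s)//.
  rewrite C2E lerXn2r ?nnegrE ?divr_ge0 ?sqrtr_ge0//.
  rewrite ler_pM2l// lef_pV2 ?posrE ?sqrtr_gt0//.
  by rewrite ler_wsqrtr.
pose A := \int[leb_itv M]_t m t.
have EA : \int[leb_box M n.+1]_z \1_E z = A.
  by rewrite leb_box_integral_trcons//; exact: bm_indic.
rewrite EA hat_sqr_correlation.
have bq : bounded_measurable (fun p : R * R => q p.1 p.2).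
  apply: (bm_integral (leb_box 1 n) (f := fun (p : R * R) y =>
    cc p.1 y * cc p.2 y + ss p.1 y * ss p.2 y)).
  apply: (bm_comp bm_corr (g := fun p : R * R * n.-tuple R =>
    ((p.2, p.1.1), p.1.2))).
  apply: measurable_fun_pair; last exact: measurableT_comp.
  by apply: measurable_fun_pair => //; exact: measurableT_comp.
have b1 : bounded_measurable (fun p : R * R => near p.1 p.2 * m p.1) by exact: bmM.
have b2 : bounded_measurable (fun p : R * R => near p.1 p.2 * m p.2) by exact: bmM.
have b3 : bounded_measurable (fun p : R * R => m p.1 * m p.2) by exact: bmM.
have bZ (c : R) (f : R -> R -> R) : bounded_measurable (fun p : R * R => f p.1 p.2) ->
    bounded_measurable (fun p : R * R => c * f p.1 p.2).
  by move=> bf; apply: bmM => //; exact: bm_cst.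
have i2Z (c : R) (f : R -> R -> R) : bounded_measurable (fun p : R * R => f p.1 p.2) ->
    \int[leb_itv M]_t \int[leb_itv M]_s (c * f t s) =
    c * \int[leb_itv M]_t \int[leb_itv M]_s f t s.
  move=> bf; rewrite -bm_integralZl; last exact: bm_integral.
  by apply: eq_integralT => t; rewrite bm_integralZl//; exact: bm_section1.
have i2D (f g : R -> R -> R) : bounded_measurable (fun p : R * R => f p.1 p.2) ->
    bounded_measurable (fun p : R * R => g p.1 p.2) ->
    \int[leb_itv M]_t \int[leb_itv M]_s (f t s + g t s) =
    \int[leb_itv M]_t \int[leb_itv M]_s f t s +
    \int[leb_itv M]_t \int[leb_itv M]_s g t s.
  move=> bf bg; rewrite -bm_integralD; [|exact: bm_integral..].
  by apply: eq_integralT => t; rewrite bm_integralD//; exact: bm_section1.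
have I1 : \int[leb_itv M]_t \int[leb_itv M]_s (near t s * m t) <= 2 * rho * A.
  rewrite /A -bm_integralZl//; apply: bm_le_integral.
  - exact: (bm_integral (leb_itv M) (f := fun t s => near t s * m t)).
  - by apply: bmM => //; exact: bm_cst.
  - move=> t; rewrite bm_integralZr; last exact: (bm_section1 (f := near) t).
    by rewrite ler_wpM2r.
have I2 : \int[leb_itv M]_t \int[leb_itv M]_s (near t s * m s) <= 2 * rho * A.
  rewrite (bm_fubini (leb_itv M) (leb_itv M)
    (f := fun t s => near t s * m s) b2).
  apply: le_trans I1; rewrite le_eqVlt; apply/orP; left; apply/eqP.
  by apply: eq_integralT => t; apply: eq_integralT => s; rewrite nearC.
have I3 : \int[leb_itv M]_t \int[leb_itv M]_s (m t * m s) = A ^+ 2.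
  under eq_integralT do rewrite bm_integralZl//.
  by rewrite bm_integralZr.
apply: (@le_trans _ _ (\int[leb_itv M]_t \int[leb_itv M]_s
    (C1 / 2 * (near t s * m t + near t s * m s) + C2 * (m t * m s)))).
  have bb : bounded_measurable (fun p : R * R =>
    C1 / 2 * (near p.1 p.2 * m p.1 + near p.1 p.2 * m p.2) +
      C2 * (m p.1 * m p.2)).
    by apply: bmD; apply: bmM => //; [exact: bm_cst|exact: bmD|exact: bm_cst].
  apply: bm_le_integral.
  - exact: bm_integral.
  - exact: (bm_integral (leb_itv M) (f := fun t s =>
      C1 / 2 * (near t s * m t + near t s * m s) + C2 * (m t * m s))).
  - move=> t; apply: bm_le_integral.
    + exact: (bm_section1 (f := q)).
    + exact: (bm_section1 (f := fun t s =>
      C1 / 2 * (near t s * m t + near t s * m s) + C2 * (m t * m s))).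
    + by move=> s; rewrite -mulrDr; exact: qle.
have b12 : bounded_measurable (fun p : R * R =>
  near p.1 p.2 * m p.1 + near p.1 p.2 * m p.2) := bmD b1 b2.
rewrite (i2D (fun t s => C1 / 2 * (near t s * m t + near t s * m s))
  (fun t s => C2 * (m t * m s))); last 2 first.
- exact: (bZ _ (fun t s => near t s * m t + near t s * m s) b12).
- exact: (bZ _ (fun t s => m t * m s) b3).
rewrite (i2Z _ (fun t s => near t s * m t + near t s * m s) b12).
rewrite (i2D (fun t s => near t s * m t) (fun t s => near t s * m s) b1 b2).
rewrite (i2Z _ (fun t s => m t * m s) b3) I3 lerD2r.
have -> : 2 * rho * C1 * A = C1 / 2 * (2 * rho * A + 2 * rho * A) by field.
apply: ler_wpM2l; last exact: lerD I1 I2.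
exact: divr_ge0 C10 (ler0n _ 2).
Qed.

End slab_decomposition.

(** * The surface measure *)

(** The input of the extension operator is merely integrable, so it enters Fubini as an unbounded
    weight in one variable against a bounded kernel; [|M| * |g|] dominates, and the first measure is
    finite. *)
Lemma fubini_weighted d1 d2 (T1 : measurableType d1) (T2 : measurableType d2)
    (R : realType) (m1 : {finite_measure set T1 -> \bar R})
    (m2 : {finite_measure set T2 -> \bar R}) (k : T1 -> T2 -> R) (g : T2 -> R) :
  bounded_measurable (fun p => k p.1 p.2) ->
  m2.-integrable setT (EFin \o g) ->
  (m1 \x m2)%E.-integrable setT (fun p => (k p.1 p.2 * g p.2)%:E).
Proof.
move=> [mk [M kM]] ig.
have mg : measurable_fun setT g by apply/measurable_EFinP/(measurable_int m2).
have mkg : measurable_fun setT (fun p : T1 * T2 => (k p.1 p.2 * g p.2)%:E).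
  apply/measurable_EFinP; apply: measurable_funM => //.
  exact: measurableT_comp.
have mkx x : measurable_fun setT (fun y => k x y * g y).
  apply: measurable_funM => //.
  exact: (measurableT_comp mk (pair1_measurable x)).
apply/integrable12ltyP => //=.
have [_ gfin] := integrableP _ _ _ ig.
have gf : (\int[m2]_y `|(g y)%:E| \is a fin_num)%E.
  by rewrite ge0_fin_numE//; exact: integral_ge0.
have M0 : T1 -> T2 -> 0 <= M by move=> x y; exact: le_trans (kM (x, y)).
apply: (@le_lt_trans _ _ (\int[m1]_x (`|M|%:E * \int[m2]_y `|(g y)%:E|))%E).
  apply: ge0_le_integral => //.
  - by move=> x _; exact: integral_ge0.
  - apply: (measurable_fun_fubini_tonelli_F
      (fun p : T1 * T2 => `|(k p.1 p.2 * g p.2)%:E|%E)) => //.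
    exact: measurableT_comp.
  - move=> x _; rewrite -ge0_integralZl//; last first.
      by apply: measurableT_comp => //; exact/measurable_EFinP.
    apply: ge0_le_integral => //.
    + by apply: measurableT_comp => //; apply: measurableT_comp => //; exact: mkx.
    + apply: measurable_funeM; apply: measurableT_comp => //.
      exact/measurable_EFinP.
    + move=> y _; rewrite /= -EFinM lee_fin normrM ?normr_id ler_wpM2r//.
      exact: le_trans (kM (x, y)) (ler_norm _).
rewrite integral_cst// -(fineK gf) -EFinM.
by rewrite lte_mul_pinfty ?lee_fin ?mulr_ge0 ?fine_ge0 ?integral_ge0//
  ltey_eq fin_num_measure.
Qed.

Section surface.
Context {R : realType}.

Definition surface_constant n : R := 1 + 4 * n.-1%:R.

Lemma surface_constant_ge1 n : 1 <= surface_constant n.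
Proof. by rewrite lerDl mulr_ge0. Qed.

(** The square root of a number that is at least 1 does not exceed the number itself, and [|y|^2] is
    at most the dimension on the cube. *)
Lemma surface_density_le n (y : n.-1.-tuple R) : cube n.-1 y ->
  surface_density y <= surface_constant n.
Proof.
move=> cy.
have dn : dotp y y <= n.-1%:R.
  rewrite -[X in X%:R](card_ord n.-1) -sum1_card natr_sum; apply: ler_sum => i _.
  by have /andP[h1 h2] := cy i; nra.
rewrite /surface_density enorm_sqr.
have u1 : 1 <= 1 + 4 * dotp y y by rewrite lerDl mulr_ge0// dotp_ge0.
apply: (@le_trans _ _ (1 + 4 * dotp y y)); last by rewrite lerD2l ler_wpM2l.
have s1 : 1 <= Num.sqrt (1 + 4 * dotp y y) by rewrite -[leLHS]sqrtr1 ler_wsqrtr.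
rewrite -[leRHS]sqr_sqrtr ?(le_trans _ u1)// expr2 ler_peMl//.
Qed.

(** Comparison with the image of Lebesgue measure on the cube: it yields finiteness of the surface
    measure and lets energies on the surface be estimated over [leb_box 1]. *)
Lemma surface_measure_le n (A : set (n.-tuple R)) : measurable A ->
  (surface_measure n A <= (surface_constant n)%:E *
     leb_box 1%R n.-1 (@lift_paraboloid R n @^-1` A))%E.
Proof.
move=> mA.
have mlA : measurable (@cube R n.-1 `&` @lift_paraboloid R n @^-1` A).
  apply: measurableI; first exact: measurable_cube.
  by rewrite -[X in measurable X]setTI; exact: measurable_lift_paraboloid.
rewrite [leRHS](_ : _ = (\int[lebesgue_tuple n.-1]_(y in
    @cube R n.-1 `&` @lift_paraboloid R n @^-1` A) (surface_constant n)%:E)%E).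
  apply: ge0_le_integral => //.
  - by move=> y _; rewrite lee_fin sqrtr_ge0.
  - apply/measurable_EFinP; apply: measurable_funTS.
    exact: measurable_surface_density.
  - by move=> y [cy _]; rewrite lee_fin; exact: surface_density_le.
by rewrite integral_cst// /leb_box /mrestr setIC.
Qed.

Let surface_measure_fin n : fin_num_fun (@surface_measure R n).
Proof.
move=> A mA; rewrite ge0_fin_numE//; apply: le_lt_trans (surface_measure_le mA) _.
have mlA : measurable (@lift_paraboloid R n @^-1` A).
  by rewrite -[X in measurable X]setTI; exact: measurable_lift_paraboloid.
rewrite lte_mul_pinfty// ?lee_fin ?(le_trans _ (surface_constant_ge1 n))//.
by rewrite ltey_eq fin_num_measure.
Qed.

HB.instance Definition _ n := Measure_isFinite.Build _ _ _
  (@surface_measure R n) (@surface_measure_fin n).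

Lemma surface_integral_le n (h : n.-tuple R -> R) : bounded_measurable h ->
  (forall x, 0 <= h x) ->
  \int[surface_measure n]_x h x <=
  surface_constant n * \int[leb_box 1 n.-1]_y h (lift_paraboloid y).
Proof.
move=> bh h0; have [mh _] := bh.
have S0 : 0 <= surface_constant n by exact: le_trans (surface_constant_ge1 n).
pose S := NngNum S0.
have bl : bounded_measurable (fun y => h (@lift_paraboloid R n y)).
  by apply: (bm_comp bh); exact: measurable_lift_paraboloid.
rewrite -lee_fin EFinM -!bm_integralE//.
have ml := @measurable_lift_paraboloid R n.
have mEh : measurable_fun setT (EFin \o h) by exact/measurable_EFinP.
have := ge0_integral_pushforward ml (leb_box 1 n.-1) (D := setT) (f := EFin \o h)
  measurableT mEh.
rewrite preimage_setT => <-; last by move=> y _; rewrite lee_fin.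
rewrite -[X in (_ <= X)%E](ge0_integral_mscale _ measurableT S mEh); last first.
  by move=> x _; rewrite lee_fin.
apply: ge0_le_measure_integral => //.
by move=> A mA; exact: surface_measure_le.
Qed.

End surface.

Lemma bm_mul_integrable d (T : measurableType d) (R : realType)
    (mu : {measure set T -> \bar R}) (k g : T -> R) :
  bounded_measurable k -> mu.-integrable setT (EFin \o g) ->
  mu.-integrable setT (EFin \o (fun x => k x * g x)).
Proof.
move=> [mk [M kM]] ig.
have mg : measurable_fun setT g by apply/measurable_EFinP/(measurable_int mu).
have iMg : mu.-integrable setT (EFin \o (fun x => M * g x)).
  have := integrableZl measurableT M ig.
  by congr integrable; apply/funext => x; rewrite /= EFinM.
apply: (le_integrable measurableT _ _ iMg).
  by apply/measurable_EFinP; exact: measurable_funM.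
move=> x _; rewrite /= lee_fin !normrM ler_wpM2r//.
exact: le_trans (kM x) (ler_norm _).
Qed.

Section weighted_fubini.
Context d1 d2 (T1 : measurableType d1) (T2 : measurableType d2) (R : realType).
Variables (m1 : {finite_measure set T1 -> \bar R}).
Variables (m2 : {finite_measure set T2 -> \bar R}).
Variables (k : T1 -> T2 -> R) (g : T2 -> R).
Hypothesis bk : bounded_measurable (fun p => k p.1 p.2).
Hypothesis ig : m2.-integrable setT (EFin \o g).

Let fin1 x : (\int[m2]_y (k x y * g y)%:E = (\int[m2]_y (k x y * g y))%:E)%E.
Proof.
rewrite fineK//; apply: integrable_fin_num => //.
by apply: bm_mul_integrable => //; exact: (bm_section1 x bk).
Qed.

Lemma measurable_weighted_integral :
  measurable_fun setT (fun x => \int[m2]_y (k x y * g y)).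
Proof.
apply/measurable_EFinP.
have := measurable_fubini_F (fubini_weighted m1 bk ig).
congr measurable_fun; apply/funext => x.
by rewrite /fubini_F /= fin1.
Qed.

Lemma bm_weighted_integral :
  bounded_measurable (fun x => \int[m2]_y (k x y * g y)).
Proof.
split; first exact: measurable_weighted_integral.
have [_ [M kM]] := bk.
have iag : m2.-integrable setT (EFin \o (fun y => `|g y|)).
  exact: (integrable_norm ig).
have iMg := bm_mul_integrable (bm_cst T2 M) iag.
have ikg x : m2.-integrable setT (EFin \o (fun y => k x y * g y)).
  by apply: bm_mul_integrable => //; exact: (bm_section1 x bk).
exists (\int[m2]_y (M * `|g y|)) => x.
apply: (le_trans (le_normr_Rintegral _ _)) => //.
apply: le_Rintegral => //; first exact: (integrable_norm (ikg x)).
by move=> y _; rewrite normrM ler_wpM2r//; exact: (kM (x, y)).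
Qed.

Lemma integral_weighted_fubini :
  \int[m1]_x \int[m2]_y (k x y * g y) = \int[m2]_y ((\int[m1]_x k x y) * g y).
Proof.
congr fine.
transitivity (\int[m1]_x \int[m2]_y (k x y * g y)%:E)%E.
  by apply: eq_integral => x _; rewrite fin1.
rewrite (Fubini (fubini_weighted m1 bk ig)); apply: eq_integral => y _ /=.
have bky : bounded_measurable (fun x => k x y) by exact: (bm_section2 y bk).
rewrite -bm_integralZr// bm_integralE//.
by apply: bmM => //; exact: bm_cst.
Qed.

End weighted_fubini.

(** * The weak-type bound *)

Section weak_type.
Context {R : realType}.
Variable n : nat.
Let sigma := @surface_measure R n.+1.
Let T := n.+1.-tuple R.
Implicit Types (f : T -> R) (N : R) (z : T).

(** [N] is an upper bound for the norm and not the norm itself, so it may be taken positive even for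
    the zero function. *)
Definition square_integral_le (f1 f2 : T -> R) N : Prop :=
  [/\ measurable_fun setT f1, measurable_fun setT f2 &
  (\int[sigma]_xi (f1 xi ^+ 2 + f2 xi ^+ 2)%:E <= (N ^+ 2)%:E)%E].

(* The real part of the extension of [f1 + i f2]; replacing [(f1, f2)] by
   [(f2, - f1)] gives the imaginary part. *)
Definition extension_re (f1 f2 : T -> R) z : R :=
  \int[sigma]_xi (cos (2 * pi * dotp z xi) * f1 xi)
  - \int[sigma]_xi (sin (2 * pi * dotp z xi) * f2 xi).

Section fixed_functions.
Variables (f1 f2 : T -> R) (N : R).
Hypothesis N0 : 0 < N.
Hypothesis hf : square_integral_le f1 f2 N.

Let mf1 : measurable_fun setT f1. Proof. by case: hf. Qed.
Let mf2 : measurable_fun setT f2. Proof. by case: hf. Qed.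

Lemma square_sum_integrable :
  sigma.-integrable setT (EFin \o (fun xi => f1 xi ^+ 2 + f2 xi ^+ 2)).
Proof.
case: hf => _ _ fN; apply/integrableP; split.
  by apply/measurable_EFinP; apply: measurable_funD; exact: measurable_funX.
apply: le_lt_trans (ltry (N ^+ 2)); apply: le_trans fN.
rewrite le_eqVlt; apply/orP; left; apply/eqP; apply: eq_integral => xi _ /=.
by rewrite ger0_norm// addr_ge0 ?sqr_ge0.
Qed.

Lemma square_sum_integral_le : \int[sigma]_xi (f1 xi ^+ 2 + f2 xi ^+ 2) <= N ^+ 2.
Proof.
rewrite -lee_fin fineK; first by case: hf.
by apply: integrable_fin_num => //; exact: square_sum_integrable.
Qed.

Let idom : sigma.-integrable setT
  (EFin \o (fun xi => N + N^-1 * (f1 xi ^+ 2 + f2 xi ^+ 2))).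
Proof.
have h1 := bm_integrable sigma (bm_cst T N).
have h2 := bm_mul_integrable (bm_cst T N^-1) square_sum_integrable.
have := integrableD measurableT h1 h2.
by congr integrable; apply/funext => x.
Qed.

(** Young's inequality in place of Cauchy-Schwarz. The right side integrates to at most
    [(sigma setT + 1) * N], which gives integrability of both components and explains
    [extension_bound]. *)
Let abs_le (a b : R) : `|a| + `|b| <= N + N^-1 * (a ^+ 2 + b ^+ 2).
Proof.
rewrite -subr_ge0.
have -> : N + N^-1 * (a ^+ 2 + b ^+ 2) - (`|a| + `|b|) =
  N^-1 * ((`|a| - N / 2) ^+ 2 + (`|b| - N / 2) ^+ 2 + N ^+ 2 / 2).
  rewrite -[a ^+ 2]real_normK ?num_real// -[b ^+ 2]real_normK ?num_real//.
  by field; rewrite gt_eqF.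
by rewrite mulr_ge0 ?invr_ge0 ?(ltW N0)// !addr_ge0 ?sqr_ge0// divr_ge0 ?sqr_ge0.
Qed.

Lemma left_integrable : sigma.-integrable setT (EFin \o f1).
Proof.
apply: (le_integrable measurableT _ _ idom); first exact/measurable_EFinP.
move=> x _; rewrite /= lee_fin; apply: le_trans (ler_norm _).
by apply: le_trans (abs_le _ (f2 x)); rewrite lerDl.
Qed.

Lemma right_integrable : sigma.-integrable setT (EFin \o f2).
Proof.
apply: (le_integrable measurableT _ _ idom); first exact/measurable_EFinP.
move=> x _; rewrite /= lee_fin; apply: le_trans (ler_norm _).
by apply: le_trans (abs_le (f1 x) _); rewrite lerDr.
Qed.

Let bcos : bounded_measurable (fun p : T * T => cos (2 * pi * dotp p.1 p.2)).
Proof. by apply: bm_cos; apply: measurable_funM => //; exact: measurable_dotp. Qed.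

Let bsin : bounded_measurable (fun p : T * T => sin (2 * pi * dotp p.1 p.2)).
Proof. by apply: bm_sin; apply: measurable_funM => //; exact: measurable_dotp. Qed.

Let icos z : sigma.-integrable setT
  (EFin \o (fun xi => cos (2 * pi * dotp z xi) * f1 xi)).
Proof.
apply: bm_mul_integrable left_integrable.
exact: (bm_section1 (f := fun z xi => cos (2 * pi * dotp z xi)) z bcos).
Qed.

Let isin z : sigma.-integrable setT
  (EFin \o (fun xi => sin (2 * pi * dotp z xi) * f2 xi)).
Proof.
apply: bm_mul_integrable right_integrable.
exact: (bm_section1 (f := fun z xi => sin (2 * pi * dotp z xi)) z bsin).
Qed.

Lemma extension_reE z : extension_re f1 f2 z =
  \int[sigma]_xi (cos (2 * pi * dotp z xi) * f1 xi
                  - sin (2 * pi * dotp z xi) * f2 xi).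
Proof. by rewrite RintegralB. Qed.

Lemma extension_reN z :
  extension_re (fun x => - f1 x) (fun x => - f2 x) z = - extension_re f1 f2 z.
Proof.
rewrite /extension_re.
under eq_integralT do rewrite mulrN -mulN1r.
under [X in _ - X]eq_integralT do rewrite mulrN -mulN1r.
by rewrite !RintegralZl// !mulN1r opprB opprK addrC.
Qed.

Lemma measurable_extension_re : measurable_fun setT (extension_re f1 f2).
Proof.
apply: measurable_funB.
  (* [leb_box 1 n.+1] is an arbitrary finite measure in [z]: Fubini for it delivers measurability of
     the partial integral. *)
  exact: (measurable_weighted_integral (leb_box 1 n.+1) (m2 := sigma)
    (k := fun z xi => cos (2 * pi * dotp z xi)) bcos left_integrable).
exact: (measurable_weighted_integral (leb_box 1 n.+1) (m2 := sigma)
  (k := fun z xi => sin (2 * pi * dotp z xi)) bsin right_integrable).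
Qed.

Definition extension_bound : R := fine (sigma setT) + 1.

Lemma extension_re_le z : extension_re f1 f2 z <= extension_bound * N.
Proof.
rewrite /extension_re -RintegralB//.
apply: (@le_trans _ _
    (\int[sigma]_xi (N + N^-1 * (f1 xi ^+ 2 + f2 xi ^+ 2)))).
  apply: le_Rintegral => //.
  - have := integrableB measurableT (icos z) (isin z).
    by congr integrable; apply/funext => x.
  - move=> xi _; apply: le_trans (abs_le _ _).
    apply: le_trans (ler_norm _) _; apply: le_trans (ler_normB _ _) _.
    rewrite !normrM; apply: lerD; rewrite ler_piMl// ler_norml.
      by rewrite cos_geN1 cos_le1.
    by rewrite sin_geN1 sin_le1.
rewrite RintegralD//; last 2 first.
- exact: (bm_integrable sigma (bm_cst T N)).
- exact: (bm_mul_integrable (bm_cst T N^-1) square_sum_integrable).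
rewrite RintegralZl//; last exact: square_sum_integrable.
rewrite Rintegral_cst// /extension_bound mulrDl mul1r [_ * N]mulrC lerD2l.
by rewrite mulrC ler_pdivrMr// -expr2 square_sum_integral_le.
Qed.

End fixed_functions.

Lemma square_integral_leN (f1 f2 : T -> R) N : square_integral_le f1 f2 N ->
  square_integral_le (fun x => - f1 x) (fun x => - f2 x) N.
Proof.
move=> [mf1 mf2 fN]; split; [exact: measurable_funN|exact: measurable_funN|].
by under eq_integral do rewrite !sqrrN.
Qed.

Lemma square_integral_le_swap (f1 f2 : T -> R) N : square_integral_le f1 f2 N ->
  square_integral_le f2 (fun x => - f1 x) N.
Proof.
move=> [mf1 mf2 fN]; split; [by []|exact: measurable_funN|].
by under eq_integral do rewrite sqrrN addrC.
Qed.

End weak_type.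

(** * Measure of the superlevel sets *)

Section level_sets.
Context {R : realType}.
Variable n : nat.
Hypothesis n0 : (0 < n)%N.
Let sigma := @surface_measure R n.+1.
Let T := n.+1.-tuple R.
Variables (f1 f2 : T -> R) (N : R).
Hypothesis N0 : 0 < N.
Hypothesis hf : square_integral_le f1 f2 N.

Definition level_set (lam : R) : set T := [set z | N * lam < extension_re f1 f2 z].

Lemma measurable_level_set lam : measurable (level_set lam).
Proof.
rewrite (_ : level_set lam = extension_re f1 f2 @^-1` `]N * lam, +oo[); last first.
  by apply/seteqP; split => z /=; rewrite in_itv/= andbT.
rewrite -[X in measurable X]setTI.
by apply: (measurable_extension_re N0 hf).
Qed.

Section fixed_level.
Variables (lam M : R).
Hypotheses (lam0 : 0 < lam) (M0 : 0 < M).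
Let E := level_set lam.
Let a := \int[leb_box M n.+1]_z \1_E z : R.

Let bE : bounded_measurable (\1_E : T -> R).
Proof. by apply: bm_indic; exact: measurable_level_set. Qed.

Let a0 : 0 <= a.
Proof. by apply: bm_integral_ge0 => z; rewrite indicE; case: (_ \in _). Qed.

Let C := cos_hat M E.
Let S := sin_hat M E.

Let bk : bounded_measurable (fun p : T * T => \1_E p.1 * cos (2 * pi * dotp p.1 p.2)).
Proof.
apply: bmM; first exact: bm_comp bE measurable_fst.
by apply: bm_cos; apply: measurable_funM => //; exact: measurable_dotp.
Qed.

Let bl : bounded_measurable (fun p : T * T => \1_E p.1 * sin (2 * pi * dotp p.1 p.2)).
Proof.
apply: bmM; first exact: bm_comp bE measurable_fst.
by apply: bm_sin; apply: measurable_funM => //; exact: measurable_dotp.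
Qed.

Let swap_pair : measurable_fun setT (fun p : T * T => (p.2, p.1)).
Proof. exact: measurable_fun_pair. Qed.

Let bC : bounded_measurable C.
Proof.
apply: (bm_integral (leb_box M n.+1) (f := fun xi z =>
  \1_E z * cos (2 * pi * dotp z xi))).
exact: (bm_comp bk swap_pair).
Qed.

Let bS : bounded_measurable S.
Proof.
apply: (bm_integral (leb_box M n.+1) (f := fun xi z =>
  \1_E z * sin (2 * pi * dotp z xi))).
exact: (bm_comp bl swap_pair).
Qed.

Let if1 : sigma.-integrable setT (EFin \o f1) := left_integrable N0 hf.
Let if2 : sigma.-integrable setT (EFin \o f2) := right_integrable N0 hf.

(** Duality: integrating the lower bound [N * lam] for the extension over the truncated level set
    and exchanging integrals pairs [f1], [f2] with the transform of the set. *)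
Let level_set_pairing :
  N * lam * a <= \int[sigma]_xi (C xi * f1 xi) - \int[sigma]_xi (S xi * f2 xi).
Proof.
pose A z := \int[sigma]_xi (\1_E z * cos (2 * pi * dotp z xi) * f1 xi).
pose B z := \int[sigma]_xi (\1_E z * sin (2 * pi * dotp z xi) * f2 xi).
have bA : bounded_measurable A.
  exact: (bm_weighted_integral (leb_box 1 n.+1) (k := fun z xi =>
    \1_E z * cos (2 * pi * dotp z xi)) bk if1).
have bB : bounded_measurable B.
  exact: (bm_weighted_integral (leb_box 1 n.+1) (k := fun z xi =>
    \1_E z * sin (2 * pi * dotp z xi)) bl if2).
rewrite -(integral_weighted_fubini (leb_box M n.+1) (k := fun z xi =>
    \1_E z * cos (2 * pi * dotp z xi)) bk if1).
rewrite -(integral_weighted_fubini (leb_box M n.+1) (k := fun z xi =>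
    \1_E z * sin (2 * pi * dotp z xi)) bl if2).
rewrite -/A -/B -bm_integralB// /a -bm_integralZl//.
apply: bm_le_integral; [by apply: bmM => //; exact: bm_cst|exact: bmB|].
move=> z; rewrite /A /B !indicE; have [zE|zE] := boolP (z \in E).
  rewrite mulr1; under eq_integralT do rewrite mul1r.
  under [X in _ <= _ - X]eq_integralT do rewrite mul1r.
  by move: zE; rewrite inE => /ltW.
rewrite mulr0; under eq_integralT do rewrite !mul0r.
under [X in _ <= _ - X]eq_integralT do rewrite !mul0r.
by rewrite subrr.
Qed.

Let energy := \int[sigma]_xi (C xi ^+ 2 + S xi ^+ 2).

Let energy0 : 0 <= energy.
Proof. by apply: bm_integral_ge0 => xi; rewrite addr_ge0 ?sqr_ge0. Qed.

Lemma bm_level_set_hat_sqr : bounded_measurable (fun xi =>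
  cos_hat M (level_set lam) xi ^+ 2 + sin_hat M (level_set lam) xi ^+ 2).
Proof. by apply: bmD; exact: bmX. Qed.

(** Cauchy-Schwarz with a free parameter: the difference of the two integrands is a sum of squares,
    and [al] is optimized afterwards. *)
Let level_set_young al : 0 < al ->
  N * lam * a <= al / 2 * N ^+ 2 + (al^-1 / 2) * energy.
Proof.
move=> al0; apply: le_trans level_set_pairing _.
have iCf : sigma.-integrable setT (EFin \o (fun xi => C xi * f1 xi)).
  exact: bm_mul_integrable.
have iSf : sigma.-integrable setT (EFin \o (fun xi => S xi * f2 xi)).
  exact: bm_mul_integrable.
have isq := square_sum_integrable hf.
have bCS : bounded_measurable (fun xi => C xi ^+ 2 + S xi ^+ 2).
  by apply: bmD; exact: bmX.
have iCS := bm_integrable sigma bCS.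
apply: (@le_trans _ _ (\int[sigma]_xi (al / 2 * (f1 xi ^+ 2 + f2 xi ^+ 2)
    + al^-1 / 2 * (C xi ^+ 2 + S xi ^+ 2)))).
  rewrite -RintegralB//; apply: le_Rintegral => //.
  - have := integrableB measurableT iCf iSf.
    by congr integrable; apply/funext => x.
  - have := integrableD measurableT (bm_mul_integrable (bm_cst T (al / 2)) isq)
      (bm_mul_integrable (bm_cst T (al^-1 / 2)) iCS).
    by congr integrable; apply/funext => x.
  - move=> xi _; rewrite -subr_ge0.
    have -> : al / 2 * (f1 xi ^+ 2 + f2 xi ^+ 2) +
      al^-1 / 2 * (C xi ^+ 2 + S xi ^+ 2) - (C xi * f1 xi - S xi * f2 xi) =
      al^-1 / 2 * ((al * f1 xi - C xi) ^+ 2 + (al * f2 xi + S xi) ^+ 2).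
      by field; rewrite gt_eqF.
    by rewrite mulr_ge0 ?divr_ge0 ?invr_ge0 ?(ltW al0)// addr_ge0 ?sqr_ge0.
rewrite RintegralD//; last 2 first.
- exact: (bm_mul_integrable (bm_cst T (al / 2)) isq).
- exact: (bm_mul_integrable (bm_cst T (al^-1 / 2)) iCS).
rewrite !RintegralZl// lerD2r ler_wpM2l ?divr_ge0 ?(ltW al0)//.
exact: (square_sum_integral_le hf).
Qed.

Lemma level_set_energy :
  (lam * \int[leb_box M n.+1]_z \1_(level_set lam) z) ^+ 2 <=
  \int[surface_measure n.+1]_xi (cos_hat M (level_set lam) xi ^+ 2
     + sin_hat M (level_set lam) xi ^+ 2).
Proof.
rewrite -/E -/a -/C -/S -/sigma -/energy.
have [->|an0] := eqVneq a 0; first by rewrite mulr0 expr0n.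
have la0 : 0 < lam * a by rewrite mulr_gt0// lt_neqAle eq_sym an0.
(* The choice [al = lam * a / N] makes the term in [N ^+ 2] exactly half of the left side. *)
have := level_set_young (divr_gt0 la0 N0).
have -> : lam * a / N / 2 * N ^+ 2 + (lam * a / N)^-1 / 2 * energy =
  N * (lam * a / 2 + (lam * a)^-1 / 2 * energy).
  by field; rewrite !gt_eqF//; move: la0; rewrite pmulr_rgt0.
rewrite -mulrA ler_pM2l// => h.
have : lam * a / 2 <= (lam * a)^-1 / 2 * energy by lra.
rewrite [leRHS]mulrAC ler_pM2r// ler_pdivlMl// -expr2; exact.
Qed.

End fixed_level.

Let S : R := surface_constant n.+1.

Let S0 : 0 < S.
Proof. by apply: lt_le_trans (surface_constant_ge1 _). Qed.

(* The Stein-Tomas exponent 2 (n' + 1) / (n' - 1) in ambient dimension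
   n' = n + 1. *)
Definition weak_exponent : R := 2 + 4 / n%:R.

(** It comes from [4 * S * 256 ^+ n * r ^+ 2 / lam ^+ 2] with
    [r ^+ 2 = 196 * (2 S)^(2/n) * lam^(-4/n)], where [196 = 14 ^+ 2]. *)
Definition weak_constant : R :=
  4 * S * 256 ^+ n * 196 * (2 * S) `^ (2 / n%:R).

Lemma level_set_box_le lam M : 0 < lam -> 0 < M ->
  \int[leb_box M n.+1]_z \1_(level_set lam) z <=
  weak_constant * lam `^ (- weak_exponent).
Proof.
move=> lam0 M0; set a := \int[_]_z _.
have a0 : 0 <= a.
  by apply: bm_integral_ge0 => z; rewrite indicE; case: (_ \in _).
have C0 : 0 <= weak_constant 
  by rewrite /weak_constant !mulr_ge0 ?exprn_ge0 ?powR_ge0 ?(ltW S0) ?ler0n.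
have [a0'|an0] := eqVneq a 0; first by rewrite a0' mulr_ge0 ?powR_ge0.
have {an0} ap : 0 < a by rewrite lt_neqAle eq_sym an0.
(* The time scale [r ^+ 2] is chosen so that the far interactions contribute at
   most half of [(lam * a) ^+ 2]. *)
pose x := 2 * S / lam ^+ 2.
have x0 : 0 < x by rewrite divr_gt0 ?exprn_gt0// mulr_gt0.
pose r := 14 * x `^ n%:R^-1.
have y0 : 0 < x `^ n%:R^-1 by rewrite powR_gt0.
have r0 : 0 < r by rewrite mulr_gt0// ltr0n.
have yn : (x `^ n%:R^-1) ^+ n = x.
  by rewrite -powR_mulrn ?powR_ge0// -powRrM mulVf ?powRr1 ?(ltW x0)// pnatr_eq0 -lt0n.
have mE := measurable_level_set lam.
have sr : Num.sqrt (r ^+ 2) = r by rewrite sqrtr_sqr ger0_norm// ltW.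
have energy_le := level_set_energy M lam0.
have bh := bm_level_set_hat_sqr lam M.
have bulk_le := surface_integral_le bh
  (fun xi => addr_ge0 (sqr_ge0 _) (sqr_ge0 _)).
have := hat_sqr_le M0 mE (exprn_gt0 2 r0).
rewrite sr -/a => slab_le.
have {energy_le bulk_le slab_le} main : (lam * a) ^+ 2 <=
    S * (2 * r ^+ 2 * 256 ^+ n * a + (14 / r) ^+ n * a ^+ 2).
  apply: le_trans energy_le _; apply: le_trans bulk_le _.
  by rewrite ler_wpM2l// ltW.
have rn : (14 / r) ^+ n = lam ^+ 2 / (2 * S).
  rewrite /r invfM mulrA divff ?pnatr_eq0// mul1r exprVn yn /x.
  by rewrite invf_div.
have r2 : r ^+ 2 = 196 * ((2 * S) `^ (2 / n%:R) * lam `^ (- (4 / n%:R))).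
  rewrite /r exprMn; congr (_ * _); first by rewrite -natrX.
  rewrite -powR_mulrn ?powR_ge0// -powRrM /x powRM ?invr_ge0 ?sqr_ge0//; last first.
    by rewrite mulr_ge0// ltW.
  rewrite [n%:R^-1 * 2]mulrC; congr (_ * _).
  rewrite -powR_mulrn ?(ltW lam0)// -powRN -powRrM; congr (_ `^ _).
  by field; rewrite pnatr_eq0 -lt0n.
(* The far term is now [(lam * a) ^+ 2 / 2] and moves to the left; one factor [a] is then cancelled,
   which is legitimate because [a] is a positive real number. *)
have {main} : a <= 4 * S * 256 ^+ n * r ^+ 2 / lam ^+ 2.
  move: main; rewrite rn.
  have [c cE] : exists c : R, c = 256 ^+ n by exists (256 ^+ n).
  rewrite -cE => main.
  rewrite ler_pdivlMr ?exprn_gt0//.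
  have : a * (a * lam ^+ 2) <= a * (4 * S * c * r ^+ 2).
    have -> : a * (a * lam ^+ 2) = 2 * (lam * a) ^+ 2 - (lam * a) ^+ 2 by ring.
    have -> : a * (4 * S * c * r ^+ 2) =
      2 * (S * (2 * r ^+ 2 * c * a + lam ^+ 2 / (2 * S) * a ^+ 2)) - (lam * a) ^+ 2.
      by field; rewrite gt_eqF.
    by rewrite lerD2r ler_pM2l.
  by rewrite ler_pM2l.
move=> /le_trans; apply; rewrite r2 le_eqVlt; apply/orP; left; apply/eqP.
rewrite /weak_constant /weak_exponent opprD powRD; last first.
  by rewrite (gt_eqF lam0) implybT.
rewrite (powR_invn 2 (ltW lam0)).
have [c cE] : exists c : R, c = 256 ^+ n by exists (256 ^+ n).
rewrite -cE; set P := (2 * S) `^ _; set L := lam `^ _; set I := lam ^- 2.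
by ring.
Qed.

(** The bound on boxes is independent of [M], so continuity of the measure from below removes the
    truncation. *)
Lemma level_set_le lam : 0 < lam ->
  (lebesgue_tuple n.+1 (level_set lam) <=
   (weak_constant * lam `^ (- weak_exponent))%:E)%E.
Proof.
move=> lam0; have mE := measurable_level_set lam.
(* The successor keeps the half-side positive, as [level_set_box_le] requires. *)
pose F k := level_set lam `&` box k.+1%:R n.+1.
have mF k : measurable (F k) by apply: measurableI => //; exact: measurable_box.
have ndF : nondecreasing_seq F.
  move=> i j ij; apply/subsetPset => z [Ez bz]; split => //.
  by apply: subset_box bz; rewrite ler_nat.
have UF : \bigcup_k F k = level_set lam.
  rewrite /F -setI_bigcupr (_ : \bigcup_i _ = setT) ?setIT//.
  apply/seteqP; split => // z _.
  have : (\bigcup_(k : nat) box (k%:R : R) n.+1) z by rewrite box_bigcup.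
  move=> [k _ bz]; exists k => //.
  by apply: subset_box bz; rewrite ler_nat.
have mU : measurable (\bigcup_k F k) by rewrite UF.
have cF := nondecreasing_cvg_mu mF mU ndF (mu := lebesgue_tuple n.+1).
rewrite -UF -(cvg_lim _ cF)//.
apply: lime_le; first by apply/cvg_ex; eexists; exact: cF.
near=> k.
rewrite [leLHS](_ : _ =
    (\int[leb_box k.+1%:R n.+1]_z \1_(level_set lam) z)%:E); last first.
  rewrite -bm_integralE; last exact: bm_indic.
  by rewrite integral_indic// setIT.
by rewrite lee_fin; apply: level_set_box_le.
Unshelve. all: by end_near. Qed.

End level_sets.

(** * Dyadic summation of a weak-type bound *)

Section dyadic_levels.
Context d (T : measurableType d) (R : realType).
Variable mu : {measure set T -> \bar R}.

(** Take the least exponent for which the dyadic value drops below [x]; it is not 0 because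
    [x <= b], and its predecessor is the witness. *)
Lemma dyadic_level (b x : R) : 0 < x -> x <= b ->
  exists k, b * 2^-1 ^+ k.+1 < x <= b * 2^-1 ^+ k.
Proof.
move=> x0 xb; have b0 : 0 < b by exact: lt_le_trans xb.
have ex : exists k, b * 2^-1 ^+ k < x.
  exists (Num.truncn (b / x)).+1; set m := (Num.truncn _).+1.
  have bx : b / x < m%:R by exact: Num.Theory.truncnS_gt.
  have m2 : m%:R < 2 ^+ m :> R by rewrite -natrX ltr_nat ltn_expl.
  rewrite exprVn ltr_pdivrMr ?exprn_gt0// mulrC -ltr_pdivrMr//.
  exact: lt_trans m2.
have [k bk kmin] := ex_minnP ex; case: k bk kmin => [|k] bk kmin.
  by move: bk; rewrite expr0 mulr1 ltNge xb.
exists k; rewrite bk/= leNgt; apply/negP => /kmin.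
by rewrite ltnn.
Qed.

(** The bound on [u] removes all high levels, and [q0 < q] makes the sum over low levels a
    convergent geometric series. [W s] need only contain the superlevel set, because the modulus of
    the extension is controlled through a union of simpler sets. *)
Lemma weak_to_strong (u : T -> R) (W : R -> set T) (C N B q0 q : R) :
  measurable_fun setT u -> 0 < N -> 0 < B -> 0 <= C -> 0 < q -> q0 < q ->
  (forall z, 0 <= u z <= N * B) ->
  (forall s, 0 < s -> measurable (W s)) ->
  (forall s, 0 < s -> (mu (W s) <= (C * s `^ (- q0))%:E)%E) ->
  (forall s z, 0 < s -> N * s < u z -> W s z) ->
  (\int[mu]_z (u z `^ q)%:E <=
   (C * 2 `^ q0 * B `^ (q - q0) / (1 - 2^-1 `^ (q - q0)) * N `^ q)%:E)%E.
Proof.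
move=> mu_ N0 B0 C0 q_gt0 q0q uNB mW muW uW.
pose h k : R := 2^-1 ^+ k.
have h0 k : 0 < h k by rewrite exprn_gt0// invr_gt0.
have Bh0 k : 0 < B * h k by rewrite mulr_gt0.
(* On the shell where [u / N] lies between [B * h k.+1] and [B * h k], [c k] bounds [u ^ q], and
   [V k] below contains the shell. *)
pose c k := (N * (B * h k)) `^ q.
have c0 k : 0 <= c k by exact: powR_ge0.
pose V k := W (B * h k.+1).
have mV k : measurable (V k) by exact: mW.
pose F k z := (c k * \1_(V k) z)%:E.
have F0 k z : (0 <= F k z)%E by rewrite lee_fin mulr_ge0.
have mF k : measurable_fun setT (F k).
  apply/measurable_EFinP; apply: measurable_funM => //.
have pointwise z : ((u z `^ q)%:E <= \sum_(k <oo) F k z)%E.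
  have /andP[u0 uB] := uNB z.
  have [z0|z0] := eqVneq (u z) 0.
    by rewrite z0 powR0 ?gt_eqF//; apply: nneseries_ge0 => k _ _.
  have uz : 0 < u z by rewrite lt_neqAle eq_sym z0.
  have [k /andP[k1 k2]] := dyadic_level uz uB.
  apply: le_trans (nneseries_lim_ge k.+1 (fun n _ _ => F0 n z)).
  rewrite big_nat_recr//= -[leLHS]add0e leeD//.
    by apply: sume_ge0.
  rewrite /F /V indicE mem_set; last first.
    by apply: uW => //; rewrite mulrA.
  rewrite mulr1 lee_fin /c mulrA.
  by apply: ge0_ler_powR; rewrite ?nnegrE// ?(ltW q_gt0)// (le_trans _ k2).
apply: (@le_trans _ _ (\int[mu]_z \sum_(k <oo) F k z)%E).
  apply: ge0_le_integral => //.
  - by move=> z _; rewrite lee_fin powR_ge0.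
  - by apply/measurable_EFinP; apply: (measurableT_comp (measurable_powR _)).
  - by apply: ge0_emeasurable_sum => //.
rewrite integral_nneseries//.
pose th : R := 2^-1 `^ (q - q0).
pose K := C * 2 `^ q0 * B `^ (q - q0) * N `^ q.
have K0 : 0 <= K by rewrite !mulr_ge0 ?powR_ge0.
have th0 : 0 <= th by exact: powR_ge0.
have th1 : th < 1.
  have e1 : 1 `^ (q - q0) = 1 :> R by rewrite powR1.
  rewrite /th -[ltRHS]e1.
  by rewrite gt0_ltr_powR ?subr_gt0 ?nnegrE ?invr_ge0// invf_lt1// ltr1n.
have term k : (\int[mu]_z F k z <= (K * th ^+ k)%:E)%E.
  rewrite /F; under eq_integral do rewrite EFinM.
  rewrite ge0_integralZl_EFin//; last by apply/measurable_EFinP.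
  rewrite integral_indic// setIT.
  apply: (@le_trans _ _ ((c k)%:E * (C * (B * h k.+1) `^ (- q0))%:E)%E).
    by apply: lee_pmul => //; [rewrite lee_fin|exact: muW].
  rewrite -EFinM lee_fin le_eqVlt; apply/orP; left; apply/eqP.
  have -> : th ^+ k = h k `^ (q - q0).
    rewrite /th /h -powR_mulrn ?powR_ge0// -powRrM mulrC powRrM.
    by rewrite powR_mulrn ?invr_ge0.
  have hB : B `^ (q - q0) = B `^ q * B `^ (- q0).
    by apply: powRD; rewrite (gt_eqF B0) implybT.
  have hh : h k `^ (q - q0) = h k `^ q * h k `^ (- q0).
    by apply: powRD; rewrite (gt_eqF (h0 k)) implybT.
  have h2 : (2^-1 : R) `^ (- q0) = 2 `^ q0.
    by rewrite -powR_inv1// -powRrM mulrNN mul1r.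
  rewrite /c /K hB// hh {2}/h exprS -/(h k).
  have N0' := ltW N0; have B0' := ltW B0; have hk0 := ltW (h0 k).
  have i0 : 0 <= 2^-1 :> R by rewrite invr_ge0.
  have Bh := mulr_ge0 B0' hk0; have ih := mulr_ge0 i0 hk0.
  by rewrite (powRM _ N0' Bh) (powRM _ B0' hk0) (powRM _ B0' ih)
    (powRM _ i0 hk0) h2; ring.
apply: (@le_trans _ _ (\sum_(k <oo) (K * th ^+ k)%:E)%E).
  apply: lee_nneseries => [k _ _|k _]; last exact: term.
  by apply: integral_ge0.
apply: lime_le.
  by apply: is_cvg_nneseries => k _ _; rewrite lee_fin mulr_ge0// exprn_ge0.
apply: nearW => m; rewrite sumEFin lee_fin.
have -> : C * 2 `^ q0 * B `^ (q - q0) / (1 - 2^-1 `^ (q - q0)) * N `^ q =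
    K / (1 - th).
  by rewrite /K -/th mulrAC.
have thN1 : th != 1 by rewrite lt_eqF.
have := geometric_seriesE K thN1.
move=> /(congr1 (fun f => f m)); rewrite /series/= /geometric/= => ->.
rewrite ler_pM2r ?invr_gt0 ?subr_gt0//.
by rewrite ler_piMr// lerBlDr lerDl exprn_ge0.
Qed.

End dyadic_levels.

(** * From weak type to the global estimate *)

Section paraboloid_measurable.
Context {R : realType}.
Variable n : nat.

Let base (z : n.+1.-tuple R) : n.-tuple R :=
  [tuple tnth z (widen_ord (leqnSn n) i) | i < n].

Let lift_nth (y : n.-tuple R) (i : 'I_n) :
  tnth (lift_paraboloid (n := n.+1) y) (widen_ord (leqnSn n) i) = tnth y i.
Proof. by rewrite tnth_mktuple /= ltn_ord (tnth_nth 0). Qed.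

Let lift_last (y : n.-tuple R) :
  tnth (lift_paraboloid (n := n.+1) y) ord_max = dotp y y.
Proof. by rewrite tnth_mktuple /= ltnn enorm_sqr. Qed.

Let base_lift (y : n.-tuple R) : base (lift_paraboloid (n := n.+1) y) = y.
Proof. by apply: eq_from_tnth => i; rewrite tnth_mktuple lift_nth. Qed.

(** An image need not be measurable, so the set is rewritten through preimages: the base lies in the
    cube and the last coordinate equals the squared norm of the base. *)
Lemma measurable_paraboloid : measurable (@paraboloid R n.+1).
Proof.
have mbase : measurable_fun setT base.
  apply/measurable_fun_tnthP => i.
  rewrite (_ : _ \o _ = fun z => tnth z (widen_ord (leqnSn n) i)).
    exact: measurable_tnth.
  by apply/funext => z /=; rewrite tnth_mktuple.
have mg : measurable_fun setT
    (fun z : n.+1.-tuple R => tnth z ord_max - dotp (base z) (base z)).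
  apply: measurable_funB; first exact: measurable_tnth.
  exact: measurable_dotp.
rewrite (_ : paraboloid n.+1 = (base @^-1` cube n) `&`
   ((fun z : n.+1.-tuple R => tnth z ord_max - dotp (base z) (base z)) @^-1` [set 0])).
  apply: measurableI.
    by rewrite -[X in measurable X]setTI; apply: mbase => //; exact: measurable_cube.
  by rewrite -[X in measurable X]setTI; apply: mg.
apply/seteqP; split => [_ [y cy <-]|z [cz /eqP]] /=.
  by rewrite base_lift lift_last subrr.
rewrite subr_eq0 => /eqP zl; exists (base z) => //.
apply: eq_from_tnth => i.
case: (unliftP ord_max i) => [j ij|->]; last by rewrite lift_last -zl.
have -> : i = widen_ord (leqnSn n) j.
  by rewrite ij; apply/val_inj; rewrite /= /bump leqNgt ltn_ord.
by rewrite lift_nth tnth_mktuple.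
Qed.

End paraboloid_measurable.

Section complex_modulus.
Context {R : realType}.

Lemma normc_sqr (z : R[i]) :
  Normc.normc z ^+ 2 = complex.Re z ^+ 2 + complex.Im z ^+ 2.
Proof. by case: z => a b /=; rewrite sqr_sqrtr// addr_ge0 ?sqr_ge0. Qed.

Lemma normc_ge0 (z : R[i]) : 0 <= Normc.normc z.
Proof. by case: z => a b /=; exact: sqrtr_ge0. Qed.

Lemma normc_le_abs (z : R[i]) :
  Normc.normc z <= `|complex.Re z| + `|complex.Im z|.
Proof.
rewrite -(@ler_pXn2r _ 2)// ?nnegrE ?normc_ge0 ?addr_ge0//.
rewrite normc_sqr sqrrD -!normrX (ger0_norm (sqr_ge0 _)) (ger0_norm (sqr_ge0 _)).
by rewrite lerD2r lerDl mulrn_wge0// mulr_ge0.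
Qed.

Lemma measurable_normc d (T : measurableType d) (f : T -> R[i]) :
  measurable_fun setT (fun x => complex.Re (f x)) ->
  measurable_fun setT (fun x => complex.Im (f x)) ->
  measurable_fun setT (fun x => Normc.normc (f x)).
Proof.
move=> mr mi.
rewrite (_ : (fun x => _) = Num.sqrt \o
    (fun x => complex.Re (f x) ^+ 2 + complex.Im (f x) ^+ 2)).
  apply: measurableT_comp.
    by apply: continuous_measurable_fun; exact: sqrt_continuous.
  by apply: measurable_funD; exact: measurable_funX.
by apply/funext => x /=; case: (f x).
Qed.

End complex_modulus.

(** * From real parts to the modulus of the extension *)

Section extension_estimates.
Context {R : realType}.
Variable n : nat.
Hypothesis n0 : (0 < n)%N.
Let sigma := @surface_measure R n.+1.
Let T := n.+1.-tuple R.
Let D : set T := paraboloid n.+1.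

Section fixed_input.
Variables (f : T -> R[i]) (N : R).
Hypotheses (N0 : 0 < N) (fL : inLp sigma D 2%:E f).
Hypothesis fN : (cLnorm sigma D 2%:E f <= N%:E)%E.

(** [inLp] gives information on the paraboloid only; extension by zero yields functions measurable
    on the whole space. *)
Let g1 : T -> R := (fun xi => complex.Re (f xi)) \_ D.
Let g2 : T -> R := (fun xi => complex.Im (f xi)) \_ D.

Let mD : measurable D. Proof. exact: measurable_paraboloid. Qed.

Let gsq : square_integral_le g1 g2 N.
Proof.
have [[mr mi] _] := fL; split.
- exact: (measurable_restrictT _ mD).1 mr.
- exact: (measurable_restrictT _ mD).1 mi.
pose F : T -> \bar R := (fun xi => (Normc.normc (f xi))%:E) \_ D.
have e (xi : T) : (`|F xi| `^ 2 = (g1 xi ^+ 2 + g2 xi ^+ 2)%:E)%E.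
  rewrite /F /g1 /g2 !patchE; case: ifPn => _.
    rewrite gee0_abs ?lee_fin ?normc_ge0// poweR_EFin.
    by rewrite powR_mulrn ?normc_ge0// normc_sqr.
  (* Outside [D] a restricted function takes the default value [point], which is 0 both in [R] and
     in the extended reals. *)
  have p0 : point = 0 :> R by [].
  have pe0 : point = 0%E :> \bar R by [].
  by rewrite p0 pe0 abse0 poweR0r ?pnatr_eq0// expr0n/= addr0.
rewrite (eq_integral (fun xi => `|F xi| `^ 2)%E); last by move=> xi _; rewrite e.
rewrite -poweR_Lnorm//.
have N2 : (N%:E `^ 2 = (N ^+ 2)%:E)%E by rewrite poweR_EFin powR_mulrn// ltW.
rewrite -N2; apply: gt0_ler_poweR => //.
- by rewrite in_itv/= leey andbT Lnorm_ge0.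
- by rewrite in_itv/= leey andbT lee_fin ltW.
Qed.

Lemma extension_ReE z : complex.Re (extension f z) = extension_re g1 g2 z.
Proof.
rewrite (extension_reE N0 gsq) /extension /cintegral /= Rintegral_mkcond.
apply: eq_integralT => xi; rewrite /g1 /g2 !patchE; case: ifPn => _.
  by case: (f xi) => a b /=; ring.
by rewrite (_ : point = 0)// !mulr0 subrr.
Qed.

Lemma extension_ImE z :
  complex.Im (extension f z) = extension_re g2 (fun x => - g1 x) z.
Proof.
rewrite (extension_reE N0 (square_integral_le_swap gsq)).
rewrite /extension /cintegral /= Rintegral_mkcond.
apply: eq_integralT => xi; rewrite /g1 /g2 !patchE; case: ifPn => _.
  by case: (f xi) => a b /=; ring.
by rewrite (_ : point = 0)// oppr0 !mulr0 subrr.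
Qed.

Let g1N : T -> R := fun x => - g1 x.
Let g2N : T -> R := fun x => - g2 x.

Let gsq1 : square_integral_le g2 g1N N := square_integral_le_swap gsq.
Let gsq2 : square_integral_le g1N g2N N := square_integral_leN gsq.
Let gsq3 : square_integral_le g2N g1 N.
Proof.
have := square_integral_leN gsq1; congr square_integral_le.
by apply/funext => x; rewrite opprK.
Qed.

Let lam2 (lam : R) : 0 < lam -> 0 < lam / 2.
Proof. by move=> l0; rewrite divr_gt0. Qed.

(** If the modulus exceeds [N * lam], then the real or the imaginary part exceeds half of it in
    absolute value. The four sets are the level sets of the real part for [f], [- i f], [- f] and
    [i f]. *)
Let W (lam : R) : set T :=
  (level_set g1 g2 N (lam / 2) `|` level_set g2 g1N N (lam / 2)) `|`
  (level_set g1N g2N N (lam / 2) `|` level_set g2N g1 N (lam / 2)).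

Let mW lam : measurable (W lam).
Proof.
by apply: measurableU; apply: measurableU; exact: measurable_level_set.
Qed.

Let W_le lam : 0 < lam ->
  (lebesgue_tuple n.+1 (W lam) <=
   (4 * weak_constant n * 2 `^ weak_exponent n * lam `^ (- weak_exponent n))%:E)%E.
Proof.
move=> l0; have h (k1 k2 : T -> R) (hk : square_integral_le k1 k2 N) :=
  level_set_le n0 N0 hk (lam2 l0).
have m (k1 k2 : T -> R) (hk : square_integral_le k1 k2 N) :=
  measurable_level_set N0 hk (lam / 2).
apply: le_trans; first by apply: measureU2; apply: measurableU; exact: m.
apply: (@le_trans _ _ (
  ((weak_constant n * (lam / 2) `^ (- weak_exponent n))%:E +
   (weak_constant n * (lam / 2) `^ (- weak_exponent n))%:E) +
  ((weak_constant n * (lam / 2) `^ (- weak_exponent n))%:E +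
   (weak_constant n * (lam / 2) `^ (- weak_exponent n))%:E))%E).
  apply: leeD.
    apply: le_trans; first by apply: measureU2; exact: m.
    by apply: leeD; exact: h.
  apply: le_trans; first by apply: measureU2; exact: m.
  by apply: leeD; exact: h.
rewrite -!EFinD lee_fin le_eqVlt; apply/orP; left; apply/eqP.
have -> : (lam / 2) `^ (- weak_exponent n) =
    lam `^ (- weak_exponent n) * 2 `^ weak_exponent n.
  rewrite powRM ?invr_ge0 ?(ltW l0)//; congr (_ * _).
  by rewrite -powR_inv1// -powRrM mulrNN mul1r.
ring.
Qed.

Let u z : R := Normc.normc (extension f z).

Let mu_ : measurable_fun setT u.
Proof.
apply: measurable_normc.
  under eq_fun do rewrite extension_ReE.
  exact: measurable_extension_re N0 gsq.
under eq_fun do rewrite extension_ImE.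
exact: measurable_extension_re N0 gsq1.
Qed.

Let u_levels (s : R) z : 0 < s -> N * s < u z -> W s z.
Proof.
move=> s0 /lt_le_trans /(_ (normc_le_abs _)).
rewrite extension_ReE extension_ImE => h.
have e1 := extension_reN N0 gsq z.
have e2 := extension_reN N0 gsq1 z.
have e3 : extension_re g2N g1 z = - extension_re g2 g1N z.
  by rewrite -e2; congr (extension_re _ _ z); apply/funext => x; rewrite opprK.
have [h1|h1] := ltP (N * (s / 2)) `|extension_re g1 g2 z|.
  move: h1; have [_ h1|_ h1] := ger0P; [by left; left|right; left].
  by rewrite /level_set /= e1.
have h2 : N * (s / 2) < `|extension_re g2 g1N z|.
  by rewrite ltNge; apply/negP => h2; move: h; rewrite /g1N ltNge => /negP; apply; lra.
move: h2; have [_ h2|_ h2] := ger0P; [by left; right|right; right].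
by rewrite /level_set /= e3.
Qed.

Lemma extension_normc_le z :
  Normc.normc (extension f z) <= N * (2 * @extension_bound R n).
Proof.
have b (k1 k2 : T -> R) (hk : square_integral_le k1 k2 N) :
    `|extension_re k1 k2 z| <= N * extension_bound n.
  rewrite ler_norml mulrC (extension_re_le N0 hk) andbT lerNl.
  by rewrite -(extension_reN N0 hk) (extension_re_le N0 (square_integral_leN hk)).
apply: le_trans (normc_le_abs _) _; rewrite extension_ReE extension_ImE.
have := lerD (b _ _ gsq) (b _ _ gsq1); move=> /le_trans; apply.
by rewrite le_eqVlt; apply/orP; left; apply/eqP; ring.
Qed.

Lemma extension_Lq_integral_le (q : R) : weak_exponent n < q ->
  (\int[lebesgue_tuple n.+1]_z (Normc.normc (extension f z) `^ q)%:E <=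
   (4 * weak_constant n * 2 `^ weak_exponent n * 2 `^ weak_exponent n
     * (2 * @extension_bound R n) `^ (q - weak_exponent n)
     / (1 - 2^-1 `^ (q - weak_exponent n)) * N `^ q)%:E)%E.
Proof.
move=> q0q.
have w0 : 0 <= weak_exponent n :> R by rewrite addr_ge0 ?divr_ge0.
apply: (weak_to_strong (W := W) mu_ N0).
- by rewrite mulr_gt0// ltr_wpDl// fine_ge0.
- by rewrite !mulr_ge0 ?powR_ge0// ?exprn_ge0 ?ler0n// ?addr_ge0 ?mulr_ge0.
- exact: le_lt_trans q0q.
- by [].
- by move=> z; rewrite normc_ge0 extension_normc_le.
- by move=> s _; exact: mW.
- exact: W_le.
- exact: u_levels.
Qed.

End fixed_input.
End extension_estimates.

(* Working with all [N] above the norm [y] covers the case [y = 0], where one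
   cannot normalize. *)
Lemma le_of_forall_bound (R : realType) (x y : \bar R) (A : R) : 0 <= A ->
  (0 <= y < +oo)%E ->
  (forall N, 0 < N -> (y <= N%:E)%E -> (x <= (A * N)%:E)%E) ->
  (x <= A%:E * y)%E.
Proof.
move=> A0 /andP[y0 yoo] h.
case: y y0 yoo h => [y|//|//]; rewrite lee_fin => y0 _ h.
apply/lee_addgt0Pr => e e0.
have A1 : 0 < A + 1 by rewrite ltr_wpDl.
have d0 : 0 < e / (A + 1) by rewrite divr_gt0.
have yN : (y%:E <= (y + e / (A + 1))%:E)%E by rewrite lee_fin lerDl ltW.
apply: le_trans (h _ (ltr_wpDl y0 d0) yN) _.
rewrite -EFinM -EFinD lee_fin mulrDr lerD2l mulrCA ler_piMr ?(ltW e0)//.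
by rewrite ler_pdivrMr// mul1r lerDl.
Qed.

Section global_estimate.
Context {R : realType}.
Variable n : nat.
Hypothesis n0 : (0 < n)%N.

Lemma extension_global_finite (q : R) : weak_exponent n < q ->
  @global_extension_estimate R n.+1 2%:E q%:E.
Proof.
move=> q0q.
have w0 : 0 <= weak_exponent n :> R by rewrite addr_ge0 ?divr_ge0.
have q0 : 0 < q by exact: le_lt_trans q0q.
pose K : R := 4 * weak_constant n * 2 `^ weak_exponent n * 2 `^ weak_exponent n
     * (2 * @extension_bound R n) `^ (q - weak_exponent n)
     / (1 - 2^-1 `^ (q - weak_exponent n)).
exists (K `^ q^-1) => f fL.
apply: le_of_forall_bound; first exact: powR_ge0.
  by rewrite Lnorm_ge0/=; case: fL.
move=> N N0 fN; rewrite /cLnorm unlock.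
have h := extension_Lq_integral_le n0 N0 fL fN q0q.
have e : (\int[lebesgue_tuple n.+1]_z
    (`|((fun x => (Normc.normc (extension f x))%:E) \_ setT) z| `^ q) =
    \int[lebesgue_tuple n.+1]_z (Normc.normc (extension f z) `^ q)%:E)%E.
  apply: eq_integral => z _; rewrite patchT ?inE//.
  by rewrite gee0_abs ?lee_fin ?normc_ge0// poweR_EFin.
rewrite e -/K in h *.
have I0 : (0 <= \int[lebesgue_tuple n.+1]_z
    (Normc.normc (extension f z) `^ q)%:E)%E.
  by apply: integral_ge0 => z _; rewrite lee_fin powR_ge0.
have K0 : 0 <= K.
  (* The sign of [K] is read off from the estimate: [K] times a positive number bounds a nonnegative
     integral. *)
  by have := le_trans I0 h; rewrite lee_fin pmulr_lge0// powR_gt0.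
have qV0 : 0 <= q^-1 by rewrite invr_ge0 ltW.
have -> : K `^ q^-1 * N = (K * N `^ q) `^ q^-1.
  rewrite powRM ?powR_ge0//; congr (_ * _).
  by rewrite -powRrM divff ?gt_eqF// powRr1// ltW.
rewrite -poweR_EFin; apply: gt0_ler_poweR => //.
- by rewrite in_itv/= leey andbT.
- by rewrite in_itv/= leey andbT lee_fin mulr_ge0 ?powR_ge0.
Qed.

Lemma extension_global_infinite : @global_extension_estimate R n.+1 2%:E +oo%E.
Proof.
have B0 : 0 <= 2 * @extension_bound R n by rewrite mulr_ge0// addr_ge0 ?fine_ge0.
exists (2 * extension_bound n) => f fL.
apply: le_of_forall_bound => //.
  by rewrite Lnorm_ge0/=; case: fL.
move=> N N0 fN; rewrite /cLnorm unlock.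
have b0 : (0%:E <= (2 * extension_bound n * N)%:E :> \bar R)%E.
  by rewrite lee_fin mulr_ge0// ltW.
case: ifPn => // _; apply/ess_sup_inf.ess_supP; apply: nearW => z.
rewrite compE patchT ?inE// gee0_abs ?lee_fin ?normc_ge0// [leRHS]mulrC.
exact: (extension_normc_le N0 fL fN z).
Qed.

End global_estimate.

Theorem theorem1p3 (R : realType) (n : nat) (hn : (2 <= n)%N) :
  (forall eps : R, 0 < eps ->
     local_extension_estimate n 2%:E (2 * (n%:R + 1) / (n%:R - 1))%:E eps) ->
  forall q : \bar R, ((2 * (n%:R + 1) / (n%:R - 1))%:E < q)%E ->
     global_extension_estimate n 2%:E q.
Proof.
move=> _; case: n hn => [//|n] n0; case => [q|_|//].
  rewrite lte_fin => hq; apply: extension_global_finite => //.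
  (* Here [n] has become the base dimension and [n.+1] the ambient one; both sides equal
     [2 (n + 2) / n]. *)
  suff -> : weak_exponent n = 2 * (n.+1%:R + 1) / (n.+1%:R - 1) :> R by [].
  have nN0 : n%:R != 0 :> R by rewrite pnatr_eq0 -lt0n.
  rewrite /weak_exponent -natr1; field.
  by rewrite addrAC subrr add0r.
exact: extension_global_infinite.
Qed.
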